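(* Let $(M,g)$ be a compact $n$-dimensional Riemannian manifold, let $m>0$, $s>n/2$, and let $h^\bullet$ be an $m$-massive Fractional Gaussian Field on $M$ of regularity $s$. Let $\lambda_1$ be the spectral gap of $\Delta$, and for each $\omega$ let $\lambda_1^\omega$ be the spectral gap of $\Delta^\omega$, the Laplace–Beltrami operator of $(M,e^{2h^\omega}g)$. Then $$\mathbf E\Big[\big|\log\lambda_1^\bullet-\log\lambda_1\big|\Big]\le\alpha\,\mathbf E\Big[\sup_{M}|h^\bullet|\Big]$$ with $\alpha=2(n-1)$ if $n\ge2$ and $\alpha=2$ if $n=1$.
   Context: $(M,g)$ is a compact connected smooth Riemannian manifold without boundary; $\Delta\le0$ its Laplace–Beltrami operator; $A_m=m^2-\frac12\Delta$. The $m$-massive Fractional Gaussian Field of regularity $s$ is the centered Gaussian random distribution $h^\bullet$ with $\mathbf E\,e^{i\langle u, h^\bullet\rangle}=\exp\big(-\frac12\|A_m^{-s/2}u\|_{L^2}^2\big)$ for $u\in\mathcal C^\infty(M)$; for $s>n/2$ it is almost surely a continuous function $h^\omega$, with which it is identified. For a.e. $\omega$, $\Delta^\omega$ is the self-adjoint operator on $L^2(e^{nh^\omega}\mathrm{vol}_g)$ with $\mathcal E^\omega(\varphi,\psi)=-\frac12\int(\Delta^\omega\varphi)\psi\,e^{nh^\omega}d\mathrm{vol}_g$, where $\mathcal E^\omega$ is the Dirichlet form obtained as the closure of $\frac12\int\langle\nabla\varphi,\nabla\psi\rangle_ge^{(n-2)h^\omega}d\mathrm{vol}_g$, $\varphi,\psi\in\mathcal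 C^\infty(M)$. The spectral gap is the smallest non-zero spectral value: $\lambda_1^\omega=\inf(\mathrm{spec}(-\Delta^\omega)\setminus\{0\})$, and likewise $\lambda_1=\inf(\mathrm{spec}(-\Delta)\setminus\{0\})$. *)

(* Defs.v *)
From mathcomp Require Import all_boot all_order all_algebra.
From mathcomp Require Import all_classical all_reals all_analysis.

Set Implicit Arguments.
Unset Strict Implicit.
Unset Printing Implicit Defensive.

Import Order.TTheory GRing.Theory Num.Theory.
Import numFieldNormedType.Exports.

Local Open Scope classical_set_scope.
Local Open Scope ring_scope.

Notation borel M := (g_sigma_algebraType (@open M)).

(* [V] is always open below, so that values outside [V] are irrelevant. *)
Fixpoint Ck_on (R : realType) (n k : nat) (V : set 'rV[R]_n)
    (f : 'rV[R]_n -> R) : Prop :=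
  if k is k'.+1 then
    (forall x, V x -> differentiable f x) /\
    (forall a : 'I_n, Ck_on k' V (fun x => 'D_(delta_mx 0 a) f x))
  else forall x, V x -> {for x, continuous f}.

Definition smooth_on (R : realType) (n : nat) (V : set 'rV[R]_n)
    (f : 'rV[R]_n -> R) : Prop := forall k, Ck_on k V f.

(* Lebesgue integral over R^n of a nonnegative Borel function, written as an
   iterated integral (Tonelli); the library has no Lebesgue measure on R^n. *)
Fixpoint integral_rV (R : realType) (n : nat) : ('rV[R]_n -> \bar R) -> \bar R :=
  if n is n'.+1 return ('rV[R]_n -> \bar R) -> \bar R then
    fun f => (\int[@lebesgue_measure R]_t
      integral_rV (fun y : 'rV[R]_n' =>
        f (row_mx (const_mx t : 'rV[R]_1) y)))%E
  else fun f => f 0.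

(* [chart_inv i] is meaningful only on the image of [chart_dom i] under
   [chart i]; [chart_at p] is a chart around [p]. *)
Record smooth_atlas (R : realType) (n : nat) (M : topologicalType) :=
  SmoothAtlas {
  chart_index : Type ;
  chart_dom : chart_index -> set M ;
  chart : chart_index -> M -> 'rV[R]_n ;
  chart_inv : chart_index -> 'rV[R]_n -> M ;
  chart_at : M -> chart_index ;
  chart_atP : forall p, chart_dom (chart_at p) p ;
  chart_dom_open : forall i, open (chart_dom i) ;
  chart_image_open : forall i, open (chart i @` chart_dom i) ;
  chartK : forall i p, chart_dom i p -> chart_inv i (chart i p) = p ;
  chart_continuous : forall i p, chart_dom i p ->
    {for p, continuous (chart i)} ;
  chart_inv_continuous : forall i x, (chart i @` chart_dom i) x ->
    {for x, continuous (chart_inv i)} ;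
  transition_smooth : forall i j (a : 'I_n),
    smooth_on (chart i @` (chart_dom i `&` chart_dom j))
      (fun x => chart j (chart_inv i x) 0 a) }.

Definition transition (R : realType) (n : nat) (M : topologicalType)
    (X : smooth_atlas R n M) (i j : chart_index X) : 'rV[R]_n -> 'rV[R]_n :=
  fun x => chart j (chart_inv i x).

(* [metric_mx g i x] is the Gram matrix of the metric, at the point with
   coordinates [x], in the coordinate frame of the chart [i]. Since
   ['D_v f x = v *m 'J f x] on row vectors, [metric_transition] says that
   g_i(v, w) = g_j(d tau v, d tau w) for the transition map tau. *)
Record riemannian_metric (R : realType) (n : nat) (M : topologicalType)
    (X : smooth_atlas R n M) := RiemannianMetric {
  metric_mx : chart_index X -> 'rV[R]_n -> 'M[R]_n ;
  metric_sym : forall i x, (chart i @` chart_dom i) x ->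
    (metric_mx i x)^T = metric_mx i x ;
  metric_pos : forall i x, (chart i @` chart_dom i) x ->
    forall v : 'rV[R]_n, v != 0 -> 0 < (v *m metric_mx i x *m v^T) 0 0 ;
  metric_smooth : forall i (a b : 'I_n),
    smooth_on (chart i @` chart_dom i) (fun x => metric_mx i x a b) ;
  metric_transition : forall i j x,
    (chart i @` (chart_dom i `&` chart_dom j)) x ->
    metric_mx i x =
      'J (transition i j) x *m metric_mx j (transition i j x)
        *m ('J (transition i j) x)^T }.

Section RiemannianManifold.
Context (R : realType) (n : nat) (M : ptopologicalType).
Context (X : smooth_atlas R n M) (g : riemannian_metric X).

Definition smooth (f : M -> R) : Prop :=
  forall i : chart_index X,
    smooth_on (chart i @` chart_dom i) (fun x => f (chart_inv i x)).

Definition differential_at (i : chart_index X) (f : M -> R) (x : 'rV[R]_n)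
    : 'rV[R]_n :=
  \row_a 'D_(delta_mx 0 a) (fun y => f (chart_inv i y)) x.

(* <grad f, grad k>_g = g^{ab} (d_a f) (d_b k) in any chart around [p] *)
Definition grad_inner (f k : M -> R) (p : M) : R :=
  let i := chart_at X p in
  let x := chart i p in
  (differential_at i f x *m invmx (metric_mx g i x)
     *m (differential_at i k x)^T) 0 0.

Definition riemannian_volume
    (vol : {measure set (borel M) -> \bar R}) : Prop :=
  forall (i : chart_index X) (A : set (borel M)),
    measurable A -> A `<=` chart_dom i ->
    vol A = integral_rV (fun x =>
      (\1_(chart i @` A) x * Num.sqrt (\det (metric_mx g i x)))%:E).

Context (vol : {measure set (borel M) -> \bar R}).

(* Elements of L^2(w vol) are represented by functions, up to equality a.e.; [w > 0],
   so that null sets are those of [vol]. *)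

Definition L2 (w f : M -> R) : Prop :=
  measurable_fun [set: borel M] (f : borel M -> R) /\
  vol.-integrable [set: borel M] (fun x => (f x ^+ 2 * w x)%:E).

Definition L2_inner (w f k : M -> R) : R := \int[vol]_x (f x * k x * w x).

(* An operator is given by its graph: [T u f] means that [u] is in the domain
   of [T] and [T u = f]. For self-adjoint operators the spectrum of the
   complexification is real, and it is the set below. *)
Definition resolvent_set (w : M -> R) (T : (M -> R) -> (M -> R) -> Prop)
    : set R :=
  [set z : R |
    (forall u f, T u f -> f = (fun x => z * u x) %[ae vol] ->
       u = (fun=> 0) %[ae vol]) /\
    (exists C : R, forall f, L2 w f -> exists u k,
       [/\ T u k,
           (fun x => k x - z * u x) = f %[ae vol] &
           L2_inner w u u <= C * L2_inner w f f])].

Definition spectrum (w : M -> R) (T : (M -> R) -> (M -> R) -> Prop) : set R :=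
  ~` resolvent_set w T.

Definition conf_weight (h : M -> R) : M -> R := fun x => expR (n%:R * h x).

Definition pre_dirichlet (h f k : M -> R) : R :=
  2^-1 * \int[vol]_x (grad_inner f k x * expR ((n%:R - 2) * h x)).

(* A function [u] belongs to the domain of the closure E of [pre_dirichlet h]
   iff it admits such a sequence; E(u, v) is then the limit of
   [pre_dirichlet h (phi_ k) (psi_ k)] along sequences [phi_], [psi_] for [u]
   and [v], which does not depend on them because the form is closable. *)
Definition form_approx (h : M -> R) (phi_ : nat -> M -> R) (u : M -> R)
    : Prop :=
  [/\ forall k, smooth (phi_ k),
      L2 (conf_weight h) u,
      L2_inner (conf_weight h) (phi_ k \- u) (phi_ k \- u)
        @[k --> \oo] --> (0 : R) &
      forall e : R, 0 < e -> exists N, forall k l, (N <= k)%N -> (N <= l)%N ->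
        pre_dirichlet h (phi_ k \- phi_ l) (phi_ k \- phi_ l) < e].

(* Graph of the operator: [u] is in the domain of E, [f] is in
   L^2(e^{nh} vol), and E(u, v) = - 1/2 \int f v e^{nh} dvol for every [v] in
   the domain of E. *)
Definition laplacian (h u f : M -> R) : Prop :=
  L2 (conf_weight h) f /\
  exists2 phi_, form_approx h phi_ u &
    forall v psi_, form_approx h psi_ v ->
      pre_dirichlet h (phi_ k) (psi_ k)
        @[k --> \oo] --> - 2^-1 * L2_inner (conf_weight h) f v.

Definition opp_laplacian (h u f : M -> R) : Prop :=
  laplacian h u (fun x => - f x).

Definition spectral_gap (h : M -> R) : R :=
  inf [set z | spectrum (conf_weight h) (opp_laplacian h) z /\ z != 0].

Local Notation zero_fun := (fun _ : M => 0 : R).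

Definition laplacian_eigenbasis (lam : nat -> R) (e_ : nat -> M -> R) : Prop :=
  [/\ forall k, opp_laplacian zero_fun (e_ k) (fun x => lam k * e_ k x),
      forall j k, L2_inner (fun=> 1) (e_ j) (e_ k) = (j == k)%:R &
      forall f, L2 (fun=> 1) f ->
        (forall k, L2_inner (fun=> 1) f (e_ k) = 0) ->
        f = zero_fun %[ae vol]].

(* [v] is A_m^r u, for A_m = m^2 - 1/2 Delta, by the functional calculus: A_m
   acts on the k-th eigenfunction of - Delta as m^2 + lam_k / 2. *)
Definition massive_pow (m r : R) (u v : M -> R) : Prop :=
  L2 (fun=> 1) v /\
  exists lam e_, laplacian_eigenbasis lam e_ /\
    forall k, L2_inner (fun=> 1) v (e_ k) =
      (m ^+ 2 + lam k / 2) `^ r * L2_inner (fun=> 1) u (e_ k).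

Definition field_pairing (u f : M -> R) : R := \int[vol]_x (u x * f x).

(* The m-massive Fractional Gaussian Field of regularity s > n/2, as an almost
   surely continuous random function; the two expectations are the real and
   imaginary parts of E e^{i<u,h>}. *)
Definition fractional_gaussian_field (d : measure_display)
    (Omega : measurableType d) (P : probability Omega R) (m s : R)
    (h : Omega -> M -> R) : Prop :=
  {ae P, forall omega, continuous (h omega)} /\
  forall u, smooth u ->
    measurable_fun [set: Omega] (fun omega => field_pairing u (h omega)) /\
    exists2 v, massive_pow m (- s / 2) u v &
      ('E_P[fun omega => cos (field_pairing u (h omega))]
         = (expR (- 2^-1 * L2_inner (fun=> 1) v v))%:E)%E /\
      ('E_P[fun omega => sin (field_pairing u (h omega))] = 0)%E.

End RiemannianManifold.

(* Main.v *)
Require Import Defs.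
From mathcomp Require Import all_boot all_order all_algebra ring lra.
From mathcomp Require Import all_classical all_reals all_analysis.
From mathcomp Require Import measurable_realfun.

Set Implicit Arguments.
Unset Strict Implicit.
Unset Printing Implicit Defensive.

Import Order.TTheory GRing.Theory Num.Theory.
Import numFieldNormedType.Exports.

Local Open Scope classical_set_scope.
Local Open Scope ring_scope.

(** The spectral gap of the metric e^{2h} g is governed by a Rayleigh quotient.
    Let q_h(u) = int |grad u|^2 e^{(n-2) h} dvol and |u|_h^2 = int u^2 e^{nh} dvol.
    If |h| <= B then q_h and q_0 differ by a factor at most e^{|n-2| B} in either
    direction, and the norms |.|_h^2 and |.|_0^2 by a factor at most e^{nB}.  The
    gap is the largest eps such that

      eps * dist_h(u, ker q)^2 <= q_h(u)  for every u in the form domain,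

    so it changes by a factor between e^{- alpha B} and e^{alpha B}, where
    alpha = |n-2| + n, which is 2 (n-1) for n >= 2 and 2 for n = 1.  Taking
    logarithms gives the bound for every continuous h, with B = sup |h|, and
    integrating over omega gives the theorem.

    The work lies in the variational characterisation of a gap that is defined by
    means of resolvents.  It is carried out in an abstract setting: a vector space
    with a semi-inner product b, and a form q on a space D, complete for q + b,
    that is mapped into it.  This defines a nonnegative self-adjoint operator L.
    The distance to the kernel of q is encoded without the kernel ([energy_gap]):
    up to an arbitrarily small error, w is within distance sqrt(q(w) / eps) of a
    vector of arbitrarily small energy.  This condition is equivalent to
    L^2 >= eps L ([operator_gap]):
    - if v has small energy then q(u) = <L u, u - v> + q(u, v) is almost bounded
      by |L u| * |u - v|, which gives L^2 >= eps L;
    - conversely, if (L + d) u = w then v = d u is close to the projection of w on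
      the kernel, and w - v = L u.
    Finally L^2 >= eps L holds if and only if ]0, eps[ contains no spectrum.  In one
    direction the inequality bounds |(L - z) u| from below, and a self-adjoint
    operator that is bounded below is onto.  In the other one, the largest c such
    that |(L - z) u| >= c |u| is the distance from z to the spectrum; at z = eps / 2
    it is at least z, and |(L - z) u|^2 >= z^2 |u|^2 is the inequality
    L^2 >= 2 z L ([energy_gapP]).  The bottom of the spectrum outside 0 is therefore
    compared even when it is 0, or when there is no such spectrum.

    The space D for the metric e^{2h} g consists of the pairs of a function of L^2
    and a sequence of smooth functions that approximates it for q + b.  Since h is
    bounded it is the same for all h.  That its image is dense in L^2 follows from
    the eigenbasis through which the law of the field is expressed.  That smooth
    functions have finite energy follows from the continuity of
    <grad f, grad k>_g, which is independent of the chart, and from the finiteness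
    of the volume.

    Nothing is known on the measurability in omega of the spectral gap or of the
    supremum of |h|.  The expectation of a nonnegative function is a supremum over
    the simple functions that it dominates, hence it is monotone all the same. *)
(** * Semi-inner products on subsets of a vector space *)

(** The form need only be nonnegative, on a subset [A] of a space of functions:
    vectors are identified through the vanishing of [b (u - v) (u - v)], which
    avoids quotients by equality almost everywhere. *)
Record semi_inner (R : realType) (V : lmodType R) (A : set V)
    (b : V -> V -> R) : Prop := SemiInner {
  si_zero : A 0 ;
  si_lin : forall a u v, A u -> A v -> A (a *: u + v) ;
  si_sym : forall u v, A u -> A v -> b u v = b v u ;
  si_linl : forall a u v w, A u -> A v -> A w ->
    b (a *: u + v) w = a * b u w + b v w ;
  si_ge0 : forall u, A u -> 0 <= b u u }.

Definition si_cauchy (R : realType) (V : lmodType R) (b : V -> V -> R)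
    (x : nat -> V) : Prop :=
  forall e : R, 0 < e -> exists N, forall k l, (N <= k)%N -> (N <= l)%N ->
    b (x k - x l) (x k - x l) < e.

Definition si_complete (R : realType) (V : lmodType R) (A : set V)
    (b : V -> V -> R) : Prop :=
  forall x : nat -> V, (forall k, A (x k)) ->
    si_cauchy b x ->
    exists2 y, A y & forall e : R, 0 < e -> exists N, forall k, (N <= k)%N ->
      b (x k - y) (x k - y) < e.

(** The discriminant argument behind the Cauchy-Schwarz inequality. *)
Lemma quad_disc (R : realType) (p r s : R) :
  0 <= s -> (forall t, 0 <= p + 2 * t * r + t ^+ 2 * s) -> r ^+ 2 <= p * s.
Proof.
move=> s0 quad; have [s_eq0|s_neq0] := eqVneq s 0.
  have [->|r0] := eqVneq r 0; first by rewrite s_eq0 expr0n mulr0.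
  (* a nonconstant affine function of t takes negative values *)
  have := quad (- (p + 1) / (2 * r)); rewrite s_eq0.
  have -> : p + 2 * (- (p + 1) / (2 * r)) * r
    + (- (p + 1) / (2 * r)) ^+ 2 * 0 = - 1 by field.
  by rewrite lerNr oppr0 ler10.
have sgt0 : 0 < s by rewrite lt_def s_neq0.
have := quad (- r / s).
have -> : p + 2 * (- r / s) * r + (- r / s) ^+ 2 * s = (p * s - r ^+ 2) / s
  by field.
by rewrite pmulr_lge0 ?invr_gt0// subr_ge0.
Qed.

Lemma null_sequence (R : realType) : exists2 r : nat -> R, forall k, 0 < r k &
  forall e, 0 < e -> exists N, forall k, (N <= k)%N -> r k < e.
Proof.
exists (fun k => k.+1%:R^-1) => [k|e e0]; first by rewrite invr_gt0 ltr0n.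
have [N _ Nk] := near_infty_natSinv_lt (PosNum e0).
by exists N => k; exact: Nk.
Qed.

Section SemiInnerTheory.
Context (R : realType) (V : lmodType R) (A : set V) (b : V -> V -> R).
Hypothesis Ab : semi_inner A b.

Lemma siD_closed u v : A u -> A v -> A (u + v).
Proof. by move=> Au Av; rewrite -[u]scale1r; apply: (si_lin Ab). Qed.

Lemma siZ_closed a u : A u -> A (a *: u).
Proof.
by move=> Au; rewrite -[_ *: u]addr0; apply: (si_lin Ab) => //; apply: (si_zero Ab).
Qed.

Lemma siB_closed u v : A u -> A v -> A (u - v).
Proof. by move=> Au Av; rewrite addrC -scaleN1r; apply: (si_lin Ab). Qed.

Lemma siDl u v w : A u -> A v -> A w -> b (u + v) w = b u w + b v w.
Proof.
by move=> Au Av Aw; rewrite -{1}[u]scale1r (si_linl Ab)// mul1r.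
Qed.

Lemma si0l w : A w -> b 0 w = 0.
Proof.
move=> Aw; have A0 := si_zero Ab.
have := siDl A0 A0 Aw; rewrite addr0 => /esym/eqP.
by rewrite -subr_eq0 addrK => /eqP.
Qed.

Lemma siZl a u w : A u -> A w -> b (a *: u) w = a * b u w.
Proof.
move=> Au Aw; rewrite -[a *: u]addr0 (si_linl Ab)//; last exact: (si_zero Ab).
by rewrite si0l// addr0.
Qed.

Lemma siBl u v w : A u -> A v -> A w -> b (u - v) w = b u w - b v w.
Proof.
move=> Au Av Aw; rewrite addrC -scaleN1r (si_linl Ab)//.
by rewrite mulN1r addrC.
Qed.

Lemma siDr u v w : A u -> A v -> A w -> b w (u + v) = b w u + b w v.
Proof.
move=> Au Av Aw; rewrite (si_sym Ab)//; last exact: siD_closed.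
by rewrite siDl// ![b _ w](si_sym Ab).
Qed.

Lemma siZr a u w : A u -> A w -> b w (a *: u) = a * b w u.
Proof.
move=> Au Aw; rewrite (si_sym Ab)//; last exact: siZ_closed.
by rewrite siZl// ![b _ w](si_sym Ab).
Qed.

Lemma siBr u v w : A u -> A v -> A w -> b w (u - v) = b w u - b w v.
Proof.
move=> Au Av Aw; rewrite (si_sym Ab)//; last exact: siB_closed.
by rewrite siBl// ![b _ w](si_sym Ab).
Qed.

Lemma si_sqB u v : A u -> A v -> b (u - v) (u - v) = b u u - 2 * b u v + b v v.
Proof.
move=> Au Av; rewrite siBl ?siBr//; last exact: siB_closed.
by rewrite (si_sym Ab Av Au); ring.
Qed.

Lemma si_sqD u v : A u -> A v -> b (u + v) (u + v) = b u u + 2 * b u v + b v v.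
Proof.
move=> Au Av; rewrite siDl ?siDr//; last exact: siD_closed.
by rewrite (si_sym Ab Av Au); ring.
Qed.

Lemma si_sqZ a u : A u -> b (a *: u) (a *: u) = a ^+ 2 * b u u.
Proof.
by move=> Au; rewrite siZl ?siZr//; [ring|exact: siZ_closed].
Qed.

Lemma si_CS u v : A u -> A v -> b u v ^+ 2 <= b u u * b v v.
Proof.
move=> Au Av; apply: quad_disc => [|t]; first exact: (si_ge0 Ab).
have Atv := siZ_closed t Av.
have := si_ge0 Ab (siD_closed Au Atv).
by rewrite si_sqD// si_sqZ// siZr// !mulrA.
Qed.

Lemma si_null u v : A u -> A v -> b u u = 0 -> b u v = 0.
Proof.
move=> Au Av u0; have := si_CS Au Av; rewrite u0 mul0r => h.
by apply/eqP; rewrite -sqrf_eq0 eq_le h sqr_ge0.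
Qed.

Lemma si_sqD_le u v : A u -> A v -> b (u + v) (u + v) <= 2 * b u u + 2 * b v v.
Proof.
move=> Au Av; have := si_ge0 Ab (siB_closed Au Av).
by rewrite si_sqB// si_sqD// => ?; lra.
Qed.

Lemma si_tri u v w : A u -> A v -> A w ->
  b (u - w) (u - w) <= 2 * b (u - v) (u - v) + 2 * b (v - w) (v - w).
Proof.
move=> Au Av Aw; have -> : u - w = (u - v) + (v - w) by rewrite addrA subrK.
by apply: si_sqD_le; exact: siB_closed.
Qed.

Lemma si_null_sub u v w : A u -> A v -> A w -> b (u - v) (u - v) = 0 ->
  b u w = b v w.
Proof.
move=> Au Av Aw uv0; apply/eqP; rewrite -subr_eq0 -siBl//.
by rewrite si_null//; exact: siB_closed.
Qed.

Lemma si_null_eq u v : A u -> A v -> b (u - v) (u - v) = 0 -> b u u = b v v.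
Proof.
move=> Au Av uv0; rewrite (si_null_sub Au Av Au uv0) (si_sym Ab)//.
exact: si_null_sub.
Qed.

Lemma si_distC u v : A u -> A v -> b (u - v) (u - v) = b (v - u) (v - u).
Proof. by move=> Au Av; rewrite !si_sqB// (si_sym Ab Av Au); ring. Qed.

(** The representing vector minimises [b u u - 2 * F u]; minimising sequences
    are Cauchy by the parallelogram identity. *)
Lemma riesz (F : V -> R) (C : R) : si_complete A b ->
  (forall a u v, A u -> A v -> F (a *: u + v) = a * F u + F v) ->
  0 <= C -> (forall v, A v -> F v ^+ 2 <= C * b v v) ->
  exists2 u, A u & forall v, A v -> b u v = F v.
Proof.
move=> Abc FL C0 FC.
pose J u := b u u - 2 * F u.
have FZ a u : A u -> F (a *: u) = a * F u.
  move=> Au; have F0 : F 0 = 0.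
    have A0 := si_zero Ab; have := FL 1 0 0 A0 A0.
    by rewrite scale1r addr0 mul1r => /esym/eqP; rewrite -subr_eq0 addrK => /eqP.
  by rewrite -[a *: u]addr0 FL ?F0 ?addr0//; exact: (si_zero Ab).
have FD u v : A u -> A v -> F (u + v) = F u + F v.
  by move=> Au Av; rewrite -{1}[u]scale1r FL// mul1r.
have J_ge u : A u -> - C <= J u.
  move=> Au; rewrite /J; have := FC u Au; have bu := si_ge0 Ab Au => h.
  suff : 2 * F u <= b u u + C by lra.
  rewrite leNgt; apply/negP => h1.
  have : (b u u + C) ^+ 2 < (2 * F u) ^+ 2.
    by rewrite ltr_pXn2r// nnegrE; lra.
  have := sqr_ge0 (b u u - C); rewrite !expr2 in h *; nra.
pose S := [set J u | u in A].
have S0 : has_inf S.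
  split; first by exists (J 0), 0 => //; exact: (si_zero Ab).
  by exists (- C) => _ [u Au <-]; exact: J_ge.
pose m := inf S.
have m_le u : A u -> m <= J u.
  by move=> Au; apply: ge_inf; [case: S0|exists u].
have [r r0 small] := null_sequence R.
have /choice[x xP] k : exists u, A u /\ J u < m + r k.
  by have [_ [u Au <-] ?] := inf_adherent (r0 k) S0; exists u.
have Ax k : A (x k) by case: (xP k).
have Jx k : J (x k) < m + r k by case: (xP k).
have [e e0|u Au xu] := Abc x Ax.
  have [N NP] := small (e / 4) ltac:(lra).
  exists N => k l Nk Nl.
  have Akl : A (2^-1 *: (x k + x l)) by apply: siZ_closed; exact: siD_closed.
  rewrite si_sqB//; have := m_le _ Akl; rewrite /J.
  rewrite si_sqZ ?FZ ?FD ?si_sqD//; try exact: siD_closed.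
  have := Jx k; have := Jx l; have := NP _ Nk; have := NP _ Nl; rewrite /J.
  by rewrite expr2; lra.
exists u => // v Av.
have dxk k : (b (x k) v - F v) ^+ 2 <= r k * b v v.
  apply: quad_disc => [|t]; first exact: (si_ge0 Ab).
  have Atv := siZ_closed t Av.
  have := m_le _ (siD_closed (Ax k) Atv); rewrite /J.
  rewrite FD// FZ// si_sqD// siZr// si_sqZ//.
  by have := Jx k; rewrite /J; lra.
apply/eqP; rewrite -subr_eq0 -sqrf_eq0 eq_le sqr_ge0 andbT.
have bv := si_ge0 Ab Av.
apply/ler_addgt0Pr => e e0; rewrite add0r.
have d0 : 0 < e / (4 * (b v v + 1)) by rewrite divr_gt0//; lra.
have [N1 H1] := xu _ d0; have [N2 H2] := small _ d0.
pose k := maxn N1 N2.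
have {}H1 := H1 k (leq_maxl _ _); have {}H2 := H2 k (leq_maxr _ _).
have CS := si_CS (siB_closed (Ax k) Au) Av; rewrite siBl// in CS.
have := dxk k.
set p := b (x k) v in CS *; set r' := b u v in CS *.
set d := e / _ in d0 H1 H2 *.
have E : d * (b v v + 1) = e / 4.
  by rewrite /d; field; apply: lt0r_neq0; lra.
move=> h1.
have le1 : (p - F v) ^+ 2 <= e / 4.
  rewrite -E; apply: (le_trans h1); apply: ler_pM => //; try lra.
  exact: ltW.
have le2 : (p - r') ^+ 2 <= e / 4.
  rewrite -E; apply: (le_trans CS); apply: ler_pM => //; try lra.
  by apply: (si_ge0 Ab); exact: siB_closed.
have := sqr_ge0 ((p - F v) + (p - r')); rewrite !expr2 in le1 le2 *; nra.
Qed.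

End SemiInnerTheory.

Section SemiInnerCauchy.
Context (R : realType) (V : lmodType R) (A : set V) (b : V -> V -> R).
Hypothesis Ab : semi_inner A b.

Lemma si_cauchy_bounded x : (forall k, A (x k)) -> si_cauchy b x ->
  exists2 B : R, 0 < B & exists N, forall k, (N <= k)%N -> b (x k) (x k) <= B.
Proof.
move=> Ax /(_ 1 ltr01)[N NP]; exists (2 + 2 * b (x N) (x N)).
  by have := si_ge0 Ab (Ax N); lra.
exists N => k Nk; have := si_sqD_le Ab (siB_closed Ab (Ax k) (Ax N)) (Ax N).
by rewrite subrK; have := NP k N Nk (leqnn N); lra.
Qed.

(** By the Cauchy-Schwarz inequality, applied to each of the two differences
    [b (x N - x k) (y N)] and [b (x k) (y N - y k)]. *)
Lemma si_cauchy_cvg x y : (forall k, A (x k)) -> (forall k, A (y k)) ->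
  si_cauchy b x -> si_cauchy b y -> cvgn (fun k => b (x k) (y k)).
Proof.
move=> Ax Ay xC yC; apply/cauchy_cvgP/cauchy_exP => e e0.
have [B B0 [N1 BP]] := si_cauchy_bounded Ax xC.
have [C C0 [N2 CP]] := si_cauchy_bounded Ay yC.
have eC : 0 < (e / 2) ^+ 2 / C by rewrite divr_gt0// exprn_gt0// divr_gt0.
have eB : 0 < (e / 2) ^+ 2 / B by rewrite divr_gt0// exprn_gt0// divr_gt0.
have [N3 P3] := xC _ eC; have [N4 P4] := yC _ eB.
pose N := maxn (maxn N1 N2) (maxn N3 N4).
have [h1 h2 h3 h4] : [/\ (N1 <= N)%N, (N2 <= N)%N, (N3 <= N)%N & (N4 <= N)%N].
  by rewrite /N !leq_max !leqnn !orbT.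
exists (b (x N) (y N)); exists N => // k /= Nk; rewrite /ball /=.
have g1 := leq_trans h1 Nk; have g2 := leq_trans h2 Nk.
have g3 := leq_trans h3 Nk; have g4 := leq_trans h4 Nk.
have AxB := siB_closed Ab (Ax N) (Ax k); have AyB := siB_closed Ab (Ay N) (Ay k).
have small (r s t : R) : 0 < t -> 0 <= r -> r < (e / 2) ^+ 2 / t -> s <= t ->
    r * s <= (e / 2) ^+ 2.
  move=> t0 r0 rt st; apply: (@le_trans _ _ (r * t)); first by rewrite ler_wpM2l.
  by rewrite -ler_pdivlMr// ltW.
have half (r : R) : r ^+ 2 < (e / 2) ^+ 2 -> `|r| < e / 2.
  by move=> h; rewrite -(@ltr_pXn2r _ 2)// ?nnegrE ?divr_ge0 ?ltW// real_normK ?num_real.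
have e1 : `|b (x N - x k) (y N)| < e / 2.
  apply: half; apply: le_lt_trans (si_CS Ab AxB (Ay N)) _.
  have := P3 N k h3 g3; rewrite ltr_pdivlMr// => h; apply: le_lt_trans h.
  by rewrite ler_wpM2l ?(si_ge0 Ab) ?CP.
have e2 : `|b (x k) (y N - y k)| < e / 2.
  apply: half; apply: le_lt_trans (si_CS Ab (Ax k) AyB) _.
  have := P4 N k h4 g4; rewrite ltr_pdivlMr// => h; apply: le_lt_trans h.
  by rewrite mulrC ler_wpM2l ?(si_ge0 Ab) ?BP.
have -> : b (x N) (y N) - b (x k) (y k) = b (x N - x k) (y N) + b (x k) (y N - y k).
  rewrite (siBl Ab (Ax N) (Ax k) (Ay N)) (siBr Ab (Ay N) (Ay k) (Ax k)).
  by rewrite addrA subrK.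
by apply: le_lt_trans (ler_normD _ _) _; rewrite (splitr e) ltrD.
Qed.

Definition si_close (x y : nat -> V) : Prop :=
  forall e : R, 0 < e -> exists N, forall k, (N <= k)%N ->
    b (x k - y k) (x k - y k) < e.

Lemma si_close_cauchy x y : (forall k, A (x k)) -> (forall k, A (y k)) ->
  si_close x y -> si_cauchy b x -> si_cauchy b y.
Proof.
move=> Ax Ay xy xC e e0; have [N1 P1] := xC (e / 16) ltac:(lra).
have [N2 P2] := xy (e / 32) ltac:(lra).
exists (maxn N1 N2) => k l; rewrite !geq_max => /andP[k1 k2] /andP[l1 l2].
have := si_tri Ab (Ay k) (Ax k) (Ay l); have := si_tri Ab (Ax k) (Ax l) (Ay l).
rewrite (si_distC Ab (Ay k) (Ax k)).
by have := P1 k l k1 l1; have := P2 k k2; have := P2 l l2; lra.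
Qed.

Lemma si_close_limit x y z : (forall k, A (x k)) -> (forall k, A (y k)) -> A z ->
  si_close x y -> si_close y (fun=> z) -> si_close x (fun=> z).
Proof.
move=> Ax Ay Az xy yz e e0; have [N1 P1] := xy (e / 4) ltac:(lra).
have [N2 P2] := yz (e / 4) ltac:(lra).
exists (maxn N1 N2) => k; rewrite geq_max => /andP[/P1 k1 /P2 k2].
by have := si_tri Ab (Ax k) (Ay k) Az; lra.
Qed.

End SemiInnerCauchy.

(** * The self-adjoint operator of a complete form and its spectral gap *)

(** [D] stands for the completion of the space of smooth functions for the form
    norm and [iota] for its map to L^2.  This map may have a kernel, so that the
    form is defined on [D] rather than on its image. *)
Record closed_form (R : realType) (V W : lmodType R) (H : set V) (D : set W)
    (iota : W -> V) (b : V -> V -> R) (q : W -> W -> R) : Prop := ClosedForm {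
  cf_lin : forall a x y, iota (a *: x + y) = a *: iota x + iota y ;
  cf_sub : forall x, D x -> H (iota x) ;
  cf_inner : semi_inner H b ;
  cf_energy : semi_inner D q ;
  cf_inner_complete : si_complete H b ;
  cf_energy_complete :
    si_complete D (fun x y => q x y + b (iota x) (iota y)) ;
  cf_dense : forall f, H f -> (forall x, D x -> b f (iota x) = 0) ->
    b f f = 0 }.

Section FormOperator.
Context (R : realType) (V W : lmodType R) (H : set V) (D : set W).
Context (iota : W -> V) (b : V -> V -> R) (q : W -> W -> R).

(** The self-adjoint operator L of the form, as a graph: [f] represents L x. *)
Definition form_graph (x : W) (f : V) : Prop :=
  [/\ D x, H f & forall y, D y -> q x y = b f (iota y)].

Definition null (u : V) : Prop := b u u = 0.

(** [z] belongs to the resolvent set of L, up to null vectors. *)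
Definition regular (z : R) : Prop :=
  (forall x f, form_graph x f -> null (f - z *: iota x) -> null (iota x)) /\
  (exists C : R, forall f, H f -> exists x k,
     [/\ form_graph x k, null (k - z *: iota x - f) &
         b (iota x) (iota x) <= C * b f f]).

(** A form of the inequality [eps * dist(w, ker q)^2 <= q w w] in which the kernel
    of [q] is replaced with vectors of small energy.  It only involves the values
    of [b] and [q] on the diagonal, so that it passes to comparable forms. *)
Definition energy_gap (eps : R) : Prop :=
  forall w, D w -> forall eta, 0 < eta -> exists v,
    [/\ D v, q v v <= eta &
        eps * b (iota (w - v)) (iota (w - v)) <= q w w + eta].

(** The operator inequality L^2 >= eps L, that is, no spectrum in ]0, eps[. *)
Definition operator_gap (eps : R) : Prop :=
  forall x f, form_graph x f -> eps * q x x <= b f f.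

Definition bounded_below (z c : R) : Prop := forall x f, form_graph x f ->
  c * b (iota x) (iota x) <= b (f - z *: iota x) (f - z *: iota x).

Hypothesis F : closed_form H D iota b q.

Let Hb := cf_inner F.
Let Dq := cf_energy F.
Let iH := cf_sub F.

(* Closes the membership side conditions of the bilinear identities. *)
Ltac membership := by repeat lazymatch goal with
  | |- H (_ - _) => apply: (siB_closed Hb)
  | |- D (_ - _) => apply: (siB_closed Dq)
  | |- H (_ + _) => apply: (siD_closed Hb)
  | |- D (_ + _) => apply: (siD_closed Dq)
  | |- H (_ *: _) => apply: (siZ_closed Hb)
  | |- D (_ *: _) => apply: (siZ_closed Dq)
  | |- H (iota _) => apply: iH
  | |- H 0 => exact: (si_zero Hb)
  | |- D 0 => exact: (si_zero Dq)
  | |- H _ => assumption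
  | |- D _ => assumption
  end.
Local Hint Extern 0 (H _) => membership : core.
Local Hint Extern 0 (D _) => membership : core.

Let iZ a x : iota (a *: x) = a *: iota x.
Proof.
have i0 : iota 0 = 0.
  have := cf_lin F 1 0 0; rewrite !scale1r addr0 => /esym/eqP.
  by rewrite -subr_eq0 addrK => /eqP.
by have := cf_lin F a x 0; rewrite !addr0 i0 addr0.
Qed.

Let iD x y : iota (x + y) = iota x + iota y.
Proof. by have := cf_lin F 1 x y; rewrite !scale1r. Qed.

Let iB x y : iota (x - y) = iota x - iota y.
Proof. by rewrite -scaleN1r iD iZ scaleN1r. Qed.

Let Hsub z x f : D x -> H f -> H (f - z *: iota x).
Proof.
by move=> Dx Hf; apply: (siB_closed Hb) => //; apply: (siZ_closed Hb); exact: iH.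
Qed.

Let nullP u : H u -> b u u <= 0 -> null u.
Proof. by move=> Hu u0; apply/eqP; rewrite eq_le u0 (si_ge0 Hb). Qed.

Lemma form_graph_sym x f y g : form_graph x f -> form_graph y g ->
  b f (iota y) = b g (iota x).
Proof.
by move=> [Dx Hf xf] [Dy Hg yg]; rewrite -xf// -yg// (si_sym Dq).
Qed.

Lemma form_graph_sq x f : form_graph x f -> q x x = b f (iota x).
Proof. by case=> Dx _ ->. Qed.

Lemma form_graph_lin a x f y g : form_graph x f -> form_graph y g ->
  form_graph (a *: x + y) (a *: f + g).
Proof.
move=> [Dx Hf xf] [Dy Hg yg]; split.
- exact: (si_lin Dq).
- exact: (si_lin Hb).
- move=> w Dw; rewrite (si_linl Dq)// (si_linl Hb) ?xf ?yg//; exact: iH.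
Qed.

Lemma shifted_energy (d : R) : 0 < d ->
  semi_inner D (fun x y => q x y + d * b (iota x) (iota y)).
Proof.
move=> d0; split; first exact: (si_zero Dq).
- exact: (si_lin Dq).
- by move=> u v Du Dv; rewrite (si_sym Dq)// (si_sym Hb (iH Du) (iH Dv)).
- move=> a u v w Du Dv Dw.
  rewrite (si_linl Dq)// (cf_lin F) (si_linl Hb)//; ring.
- move=> u Du; rewrite addr_ge0 ?(si_ge0 Dq)//.
  by rewrite mulr_ge0 ?(si_ge0 Hb)// ltW.
Qed.

Lemma shifted_complete (d : R) : 0 < d ->
  si_complete D (fun x y => q x y + d * b (iota x) (iota y)).
Proof.
move=> d0 x Dx xC.
pose K := 1 + d; pose L := 1 + d^-1.
have dd : d * d^-1 = 1 by rewrite divff// gt_eqF.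
have di : 0 < d^-1 by rewrite invr_gt0.
have K0 : 0 < K by rewrite /K; lra.
have L0 : 0 < L by rewrite /L; lra.
have pos k l : 0 <= q (x k - x l) (x k - x l) /\
    0 <= b (iota (x k - x l)) (iota (x k - x l)).
  have Dkl := siB_closed Dq (Dx k) (Dx l).
  by split; [exact: (si_ge0 Dq)|apply: (si_ge0 Hb); exact: iH].
have [e e0|y Dy xy] := cf_energy_complete F Dx.
  have [N NP] := xC (e / L) (divr_gt0 e0 L0).
  exists N => k l Nk Nl; have := NP k l Nk Nl.
  have [] := pos k l; move: (q _ _) (b _ _) => p r p0 r0.
  rewrite ltr_pdivlMr// /L => h; have := mulr_ge0 p0 (ltW di).
  have := mulr_ge0 r0 (ltW d0).
  have E : (p + d * r) * (1 + d^-1) = p + d * r + p * d^-1 + (d * d^-1) * r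
    by ring.
  by move: h; rewrite E dd; lra.
exists y => // e e0.
have [N NP] := xy (e / K) (divr_gt0 e0 K0).
exists N => k Nk; have := NP k Nk; rewrite ltr_pdivlMr// /K.
have Dk := siB_closed Dq (Dx k) Dy.
have p0 := si_ge0 Dq Dk; have r0 := si_ge0 Hb (iH Dk).
have := mulr_ge0 p0 (ltW d0); move: (q _ _) (b _ _) p0 r0 => p r p0 r0.
by move=> *; lra.
Qed.

(** L + d is onto: this is the representation theorem for the inner product
    [q + d * b] of [D]. *)
Lemma shifted_solve (d : R) f : 0 < d -> H f ->
  exists2 x, form_graph x (f - d *: iota x) &
    d ^+ 2 * b (iota x) (iota x) <= b f f.
Proof.
move=> d0 Hf; have Sd := shifted_energy d0.
have bound v : D v -> b f (iota v) ^+ 2 <=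
    (b f f * d^-1) * (q v v + d * b (iota v) (iota v)).
  move=> Dv; have := si_CS Hb Hf (iH Dv).
  have p := mulr_ge0 (mulr_ge0 (si_ge0 Hb Hf) (si_ge0 Dq Dv)) (ltW d0).
  have di : 0 < d^-1 by rewrite invr_gt0.
  have := mulr_ge0 (mulr_ge0 (si_ge0 Hb Hf) (si_ge0 Dq Dv)) (ltW di).
  have E : b f f / d * (q v v + d * b (iota v) (iota v)) =
    b f f * q v v * d^-1 + b f f * b (iota v) (iota v) * (d * d^-1) by ring.
  rewrite E divff ?gt_eqF// mulr1; lra.
have [||x Dx xf] := riesz (F := fun v => b f (iota v)) Sd (shifted_complete d0)
    _ _ bound.
- by move=> a u v Du Dv /=; rewrite (cf_lin F) (siDr Hb)// (siZr Hb)//.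
- by rewrite mulr_ge0 ?(si_ge0 Hb)// invr_ge0 ltW.
have xg : form_graph x (f - d *: iota x).
  split => // y Dy; have := xf y Dy.
  by rewrite (siBl Hb) ?(siZl Hb)// => <-; ring.
exists x => //.
have := xf x Dx; have qx := si_ge0 Dq Dx; have := si_CS Hb Hf (iH Dx) => cs h.
have bx := si_ge0 Hb (iH Dx).
have le1 : d * b (iota x) (iota x) <= b f (iota x) by rewrite -h; lra.
have [x0|x0] := eqVneq (b (iota x) (iota x)) 0.
  by rewrite x0 mulr0 (si_ge0 Hb).
have {}bx : 0 < b (iota x) (iota x) by rewrite lt_def x0.
rewrite -(ler_pM2r bx).
have -> : d ^+ 2 * b (iota x) (iota x) * b (iota x) (iota x) =
  (d * b (iota x) (iota x)) ^+ 2 by ring.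
have db := mulr_ge0 (ltW d0) (ltW bx).
apply: (le_trans _ cs); rewrite ler_pXn2r// nnegrE//.
exact: le_trans db le1.
Qed.

(** Since L is nonnegative. *)
Lemma regular_neg (z : R) : z < 0 -> regular z.
Proof.
move=> z0; split.
  move=> x f xf n0; have [Dx Hf _] := xf; apply: nullP; first exact: iH.
  have := si_null Hb (Hsub z Dx Hf) (iH Dx) n0.
  rewrite (siBl Hb) ?(siZl Hb)//.
  rewrite -(form_graph_sq xf); have := si_ge0 Dq Dx; move: (b _ _) (q _ _).
  move=> p r; nra.
exists ((- z) ^- 2) => f Hf.
have z1 : 0 < - z by lra.
have [x xf xb] := shifted_solve z1 Hf.
exists x, (f - - z *: iota x); split => //.
  rewrite scaleNr opprK addrK subrr /null.
  by rewrite (si0l Hb)//; exact: (si_zero Hb).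
by rewrite mulrC ler_pdivlMr ?exprn_gt0// mulrC.
Qed.

(** Self-adjointness of L.  Let (L + 1) y' = f + (z + 1) y.  Then y' - y is
    orthogonal to the range of L + 1, which is everything. *)
Lemma form_graph_adjoint (z : R) y f : H y -> H f ->
  (forall x g, form_graph x g -> b y (g - z *: iota x) = b f (iota x)) ->
  exists x k, [/\ form_graph x k, null (iota x - y) &
    null (k - z *: iota x - f)].
Proof.
move=> Hy Hf adj.
have Hr : H (f + (z + 1) *: y).
  by apply: (siD_closed Hb) => //; exact: (siZ_closed Hb).
have [y' y'k _] := shifted_solve ltr01 Hr.
set k := _ - _ in y'k.
have [Dy' Hk y'P] := y'k.
have Hy' := iH Dy'; have Hd := siB_closed Hb Hy' Hy.
have orth x g : form_graph x g -> b (iota y' - y) (g + iota x) = 0.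
  move=> xg; have [Dx Hg _] := xg; have Hx := iH Dx.
  have := adj _ _ xg; have := form_graph_sym y'k xg.
  rewrite /k scale1r.
  have Hzy := siZ_closed Hb (z + 1) Hy; have Hzx := siZ_closed Hb z Hx.
  have Hgx := siD_closed Hb Hg Hx.
  rewrite (siBl Hb Hr Hy' Hx) (siDl Hb Hf Hzy Hx) (siZl Hb _ Hy Hx).
  rewrite (siBr Hb Hg Hzx Hy) (siZr Hb _ Hx Hy) (siBl Hb Hy' Hy Hgx).
  rewrite (siDr Hb Hg Hx Hy') (siDr Hb Hg Hx Hy) (si_sym Hb Hg Hy').
  by lra.
have [x xg _] := shifted_solve ltr01 Hd.
have d0 : null (iota y' - y).
  by have := orth _ _ xg; rewrite scale1r subrK.
exists y', k; split=> //.
have -> : k - z *: iota y' - f = - (z + 1) *: (iota y' - y).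
  rewrite /k -(addrA _ (- (1 *: _))) -opprD -scalerDl (addrAC _ _ (- f)).
  by rewrite (addrAC f) subrr add0r scaleNr scalerBr opprB (addrC 1).
by rewrite /null (si_sqZ Hb)// d0 mulr0.
Qed.

Lemma graph_inner (z : R) :
  semi_inner [set p : (W * V)%type | form_graph p.1 p.2]
    (fun p r => b (p.2 - z *: iota p.1) (r.2 - z *: iota r.1)).
Proof.
split.
- split=> [||y Dy] /=; [exact: (si_zero Dq)|exact: (si_zero Hb)|].
  by rewrite (si0l Dq)// (si0l Hb).
- by move=> a u v /= gu gv; exact: form_graph_lin.
- by move=> u v [? ? _] [? ? _]; exact: (si_sym Hb).
- move=> a u v w [? ? _] [? ? _] [? ? _] /=.
  rewrite (cf_lin F) scalerDr scalerA mulrC -scalerA opprD addrACA.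
  by rewrite -scalerBr (si_linl Hb).
- by move=> u [? ? _]; exact: (si_ge0 Hb).
Qed.

(** L is closed, and its graph norm is equivalent to |(L - z) x| if this is bounded
    below. *)
Lemma graph_complete (z c : R) : 0 < c -> bounded_below z c ->
  si_complete [set p : (W * V)%type | form_graph p.1 p.2]
    (fun p r => b (p.2 - z *: iota p.1) (r.2 - z *: iota r.1)).
Proof.
move=> c0 bb p pG pC.
have pD k : D (p k).1 by case: (pG k).
have pH k : H (p k).2 by case: (pG k).
have gB k l : form_graph ((p k).1 - (p l).1) ((p k).2 - (p l).2).
  by have := form_graph_lin (-1) (pG l) (pG k); rewrite !scaleN1r !(addrC (- _)).
(* the graph norm controls the components: [x] by the lower bound, [f] by the
   triangle inequality, and the energy of [x] by [b f (iota x)] *)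
pose K := c^-1 + 2 * z ^+ 2 * c^-1 + 2 + 1.
have ci : 0 < c^-1 by rewrite invr_gt0.
have zc := mulr_ge0 (sqr_ge0 z) (ltW ci).
have K0 : 0 < K by rewrite /K; lra.
have ctl x f : form_graph x f ->
    b (iota x) (iota x) <= K * b (f - z *: iota x) (f - z *: iota x) /\
    b f f <= K * b (f - z *: iota x) (f - z *: iota x).
  move=> xf; have [Dx Hf _] := xf; have := bb _ _ xf.
  have := si_sqD_le Hb (Hsub z Dx Hf) (siZ_closed Hb z (iH Dx)).
  rewrite subrK (si_sqZ Hb)//; have := si_ge0 Hb (Hsub z Dx Hf).
  have bx := si_ge0 Hb (iH Dx).
  move: (b _ _) (b _ _) (b _ _) bx => r s t r0 s0 h1; rewrite mulrC -ler_pdivlMr//.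
  move=> h2; have h3 := ler_wpM2l (sqr_ge0 z) h2.
  have sc := mulr_ge0 s0 (ltW ci); have := mulr_ge0 s0 zc.
  have := mulr_ge0 s0 (sqr_ge0 z).
  rewrite /K; move=> h4 h5; split; nra.
have pC' (e : R) : 0 < e -> exists N, forall k l, (N <= k)%N -> (N <= l)%N ->
    b (iota (p k).1 - iota (p l).1) (iota (p k).1 - iota (p l).1) < e /\
    b ((p k).2 - (p l).2) ((p k).2 - (p l).2) < e.
  move=> e0; have [N NP] := pC _ (divr_gt0 e0 K0).
  exists N => k l Nk Nl; have := NP k l Nk Nl => /=.
  rewrite ltr_pdivlMr// mulrC; have [] := ctl _ _ (gB k l); rewrite iB.
  by move=> h1 h2 h3; split; [apply: le_lt_trans h3|apply: le_lt_trans h3].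
have [e e0|x Dx xP] := cf_energy_complete F pD.
  have [N NP] := pC' (e / 2) ltac:(lra).
  exists N => k l Nk Nl; have [] := NP k l Nk Nl.
  rewrite (form_graph_sq (gB k l)) iB.
  have Hd := siB_closed Hb (iH (pD k)) (iH (pD l)).
  have := si_ge0 Hb (siB_closed Hb (siB_closed Hb (pH k) (pH l)) Hd).
  rewrite (si_sqB Hb)//.
  by move: (b _ _) (b _ _) (b _ _) => *; lra.
have [e e0|f Hf fP] := cf_inner_complete F pH.
  by have [N NP] := pC' e e0; exists N => k l Nk Nl; have [] := NP k l Nk Nl.
have xP' (e : R) : 0 < e -> exists N, forall k, (N <= k)%N ->
    [/\ q ((p k).1 - x) ((p k).1 - x) < e,
        b (iota (p k).1 - iota x) (iota (p k).1 - iota x) < e &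
        b ((p k).2 - f) ((p k).2 - f) < e].
  move=> e0; have [N1 P1] := xP e e0; have [N2 P2] := fP e e0.
  exists (maxn N1 N2) => k; rewrite geq_max => /andP[/P1 k1 /P2 k2].
  have Dk := siB_closed Dq (pD k) Dx.
  have := si_ge0 Dq Dk; have := si_ge0 Hb (iH Dk).
  by rewrite -iB; split=> //; lra.
have xf : form_graph x f.
  split=> // y Dy; apply/eqP; rewrite -subr_eq0 -sqrf_eq0 eq_le sqr_ge0 andbT.
  apply/ler_addgt0Pr => e e0; rewrite add0r.
  have yy := si_ge0 Dq Dy; have iyy := si_ge0 Hb (iH Dy).
  have s0 : 0 < 2 * (q y y + b (iota y) (iota y) + 1) by lra.
  have [N NP] := xP' _ (divr_gt0 e0 s0).
  have [] := NP N (leqnn N); rewrite !ltr_pdivlMr// => h1 _ h2.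
  have [_ _ /(_ y Dy)] := pG N.
  have := si_CS Dq (siB_closed Dq (pD N) Dx) Dy.
  rewrite (siBl Dq (pD N) Dx Dy).
  have := si_CS Hb (siB_closed Hb (pH N) Hf) (iH Dy).
  rewrite (siBl Hb (pH N) Hf (iH Dy)).
  have p1 := si_ge0 Dq (siB_closed Dq (pD N) Dx).
  have p2 := si_ge0 Hb (siB_closed Hb (pH N) Hf).
  have := mulr_ge0 p1 iyy; have := mulr_ge0 p2 yy.
  move=> m1 m2 c1 c2 E; rewrite E in c2.
  have := sqr_ge0 (b (p N).2 (iota y) - q x y + (b (p N).2 (iota y) - b f (iota y))).
  rewrite !expr2 in c1 c2 *; nra.
exists (x, f) => // e e0 /=.
have k0 : 0 < 2 + 2 * z ^+ 2 by have := sqr_ge0 z; lra.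
have [N NP] := xP' _ (divr_gt0 e0 k0).
exists N => k /NP[_]; have Hk := pH k; have Hx := iH (pD k).
have -> : (p k).2 - f - z *: iota ((p k).1 - x) =
    ((p k).2 - f) + (- z) *: (iota (p k).1 - iota x).
  by rewrite iB scaleNr.
have := si_sqD_le Hb (siB_closed Hb Hk Hf)
  (siZ_closed Hb (- z) (siB_closed Hb Hx (iH Dx))).
rewrite (si_sqZ Hb)// sqrrN !ltr_pdivlMr//.
have := sqr_ge0 z; set zz := z ^+ 2.
have := si_ge0 Hb (siB_closed Hb Hx (iH Dx)).
have := si_ge0 Hb (siB_closed Hb Hk Hf).
by move: (b _ _) (b _ _) (b _ _) => *; nra.
Qed.

(** Representing [b f] on the graph solves (L - z) (L - z) x = f weakly; by
    self-adjointness y = (L - z) x is in the domain and (L - z) y = f. *)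
Lemma regular_bounded_below (z c : R) : 0 < c -> bounded_below z c -> regular z.
Proof.
move=> c0 bb; split.
  move=> x f xf n0; have [Dx Hf _] := xf; apply: nullP => //.
  by have := bb _ _ xf; rewrite n0 pmulr_rle0.
exists c^-1 => f Hf.
have ci : 0 < c^-1 by rewrite invr_gt0.
have [|||[x g] /= xg xP] := riesz (F := fun p => b f (iota p.1)) (C := b f f / c)
    (graph_inner z) (graph_complete c0 bb).
- by move=> a u v [? ? _] [? ? _] /=; rewrite (cf_lin F) (siDr Hb)// (siZr Hb)//.
- by rewrite mulr_ge0 ?(si_ge0 Hb)// ltW.
- move=> [y k] /= yk; have [Dy Hk _] := yk.
  apply: (le_trans (si_CS Hb Hf (iH Dy))); rewrite -mulrA.
  by rewrite ler_wpM2l ?(si_ge0 Hb)// mulrC ler_pdivlMr// mulrC bb.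
have [Dx Hg _] := xg.
have [|||y [k [yk n1 n2]]] := @form_graph_adjoint z (g - z *: iota x) f => //.
  by move=> x' g' xg'; exact: (xP (x', g')).
have [Dy Hk _] := yk; exists y, k; split=> //.
rewrite mulrC ler_pdivlMr// mulrC -(si_null_eq Hb (Hsub z Dy Hk) Hf n2).
exact: bb.
Qed.

(** [q x x] is at most |L x| * |x - v| plus the small term [q x v], and |x - v| is
    at most [sqrt (q x x / eps)] up to a small error. *)
Lemma energy_gap_operator (eps : R) : 0 < eps ->
  energy_gap eps -> operator_gap eps.
Proof.
move=> e0 gap x f xf; have [Dx Hf xP] := xf.
have b0 := si_ge0 Hb Hf.
have [->|qx] := eqVneq (q x x) 0; first by rewrite mulr0.
have {}qx : 0 < q x x by rewrite lt_def qx (si_ge0 Dq).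
(* [q x x = b f (iota (x - v)) + q x v], where [v] has small energy *)
have key (t : R) : 0 < t -> t < 1 ->
    eps * q x x <= b f f + t * (b f f + 2 * eps * q x x).
  move=> t0 t1.
  have eta0 : 0 < q x x * t ^+ 2 by rewrite mulr_gt0// exprn_gt0.
  have [v [Dv qv gv]] := gap x Dx _ eta0.
  have := si_CS Hb Hf (iH (siB_closed Dq Dx Dv)).
  rewrite -xP; last exact: (siB_closed Dq).
  rewrite (siBr Dq)//; have := si_CS Dq Dx Dv.
  have := si_ge0 Hb (iH (siB_closed Dq Dx Dv)).
  move: (q x v) (q v v) (b _ _) qv gv => s r u.
  set Q := q x x in qx eta0 *; set B := b f f in b0 *.
  move=> rq eu u0 sr h.
  have s2 : s ^+ 2 <= (Q * t) ^+ 2.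
    by rewrite exprMn (le_trans sr)// expr2 -!mulrA ler_wpM2l// ltW.
  have Qt : 0 < Q * t by rewrite mulr_gt0.
  have sQ : s <= Q * t by rewrite leNgt; apply/negP => ?; rewrite !expr2 in s2; nra.
  have QQ : (Q * (1 - t)) ^+ 2 <= (Q - s) ^+ 2.
    by rewrite ler_pXn2r// ?nnegrE; nra.
  have h1 : eps * (Q * (1 - t)) ^+ 2 <= B * (Q + Q * t ^+ 2).
    apply: (@le_trans _ _ (eps * (B * u))).
      by rewrite ler_pM2l//; exact: le_trans h.
    by rewrite mulrCA ler_wpM2l.
  have h2 : eps * Q * (1 - t) ^+ 2 <= B * (1 + t ^+ 2).
    rewrite -(ler_pM2r qx).
    have -> : eps * Q * (1 - t) ^+ 2 * Q = eps * (Q * (1 - t)) ^+ 2 by ring.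
    by have -> : B * (1 + t ^+ 2) * Q = B * (Q + Q * t ^+ 2) by ring.
  have eQ := mulr_gt0 e0 qx.
  have : t ^+ 2 <= t by rewrite expr2; nra.
  rewrite !expr2 in h2 * => h3; have := ler_wpM2l b0 h3.
  have := mulr_ge0 (ltW eQ) (sqr_ge0 t); rewrite expr2; lra.
apply/ler_addgt0Pr => e e1.
set K := b f f + 2 * eps * q x x in key.
have K0 : 0 <= K by have := mulr_gt0 e0 qx; rewrite /K; lra.
have d0 : 0 < K + 1 by lra.
pose t := Order.min (2^-1) (e / (K + 1)).
have t0 : 0 < t by rewrite lt_min divr_gt0// invr_gt0 ltr0n.
have t1 : t < 1 by rewrite gt_min; apply/orP; left; lra.
have te : t * (K + 1) <= e by rewrite -ler_pdivlMr// ge_min lexx orbT.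
by have := key t t0 t1; nra.
Qed.

Lemma operator_gap_bounded_below (eps z : R) : 0 < z -> z < eps ->
  operator_gap eps ->
  exists2 c : R, 0 < c & bounded_below z c.
Proof.
move=> z0 ze gap.
have expand x f : form_graph x f -> b (f - z *: iota x) (f - z *: iota x) =
    b f f - 2 * z * q x x + z ^+ 2 * b (iota x) (iota x).
  move=> xf; have [Dx Hf _] := xf.
  by rewrite (si_sqB Hb)// (siZr Hb)// (si_sqZ Hb)// (form_graph_sq xf); ring.
have [z2|z2] := leP (2 * z) eps.
  exists (z ^+ 2); first by rewrite exprn_gt0.
  move=> x f xf; rewrite expand//; have := gap _ _ xf; have [Dx _ _] := xf.
  by have := si_ge0 Dq Dx; nra.
exists ((eps - z) ^+ 2); first by rewrite exprn_gt0// subr_gt0.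
move=> x f xf; rewrite expand//; have := gap _ _ xf; have [Dx Hf _] := xf.
have := si_ge0 Hb (siB_closed Hb Hf (siZ_closed Hb eps (iH Dx))).
rewrite (si_sqB Hb)// (siZr Hb)// (si_sqZ Hb)// -(form_graph_sq xf).
set A := b f f; set Q := q x x; set U := b (iota x) (iota x) => h1 h2.
have e0 : 0 < eps by lra.
(* (L - z)^2 - (eps - z)^2 is a combination, with nonnegative coefficients, of
   L^2 - eps L and (L - eps)^2 *)
rewrite -subr_ge0 -(pmulr_rge0 _ e0).
have E : eps * (A - 2 * z * Q + z ^+ 2 * U - (eps - z) ^+ 2 * U) =
  2 * (eps - z) * (A - eps * Q) +
  (2 * z - eps) * (A - 2 * (eps * Q) + eps ^+ 2 * U) by ring.
by rewrite E addr_ge0// mulr_ge0//; lra.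
Qed.

Lemma energy_gap_regular (eps z : R) : 0 < z -> z < eps ->
  energy_gap eps -> regular z.
Proof.
move=> z0 ze gap; have e0 := lt_trans z0 ze.
have [c c0 bb] := operator_gap_bounded_below z0 ze (energy_gap_operator e0 gap).
exact: regular_bounded_below bb.
Qed.

(** If (L + d) u = w then [d *: u] has small energy as d tends to 0, and
    w - d u = L u, whose square is at most [q u w] and at least [eps * q u u]. *)
Lemma operator_gap_energy (eps : R) : 0 < eps ->
  operator_gap eps -> energy_gap eps.
Proof.
move=> e0 gap w Dw eta eta0.
have Hw := iH Dw; have w0 := si_ge0 Hb Hw.
pose d := eta / (b (iota w) (iota w) + 1).
have d0 : 0 < d by rewrite divr_gt0//; lra.
have [u uf ub] := shifted_solve d0 Hw; have [Du Hf uP] := uf.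
have qu := si_ge0 Dq Du; have qw := si_ge0 Dq Dw; have f0 := si_ge0 Hb Hf.
have Ed : d * (b (iota w) (iota w) + 1) = eta.
  by rewrite divfK// gt_eqF//; lra.
exists (d *: u); split=> //.
  rewrite (si_sqZ Dq)// -Ed expr2 -mulrA ler_pM2l//.
  have := f0; rewrite (si_sqB Hb)// (siZr Hb)// (si_sqZ Hb)//.
  rewrite (form_graph_sq uf) (siBl Hb)// (siZl Hb)//.
  have := sqr_ge0 d => d2; have := mulr_ge0 d2 (si_ge0 Hb (iH Du)).
  by move: (b _ _) (b _ _) (b _ _) w0 => x y t; rewrite !expr2; lra.
rewrite iB iZ; have := gap _ _ uf; have := si_CS Dq Du Dw.
have uw := uP w Dw; have uu := uP u Du.
have E : b (iota w - d *: iota u) (iota w - d *: iota u) = q u w - d * q u u.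
  by rewrite [in LHS](siBr Hb)// (siZr Hb)// -uw -uu.
move: f0; rewrite E; move: (q u w) (q u u) (q w w) qu qw => r p s p0 s0.
have dp := mulr_ge0 (ltW d0) p0; set B := r - _ => B0 h1 h2.
have [->|B1] := eqVneq B 0; first by rewrite mulr0; lra.
have {B1}B0 : 0 < B by rewrite lt_def B1.
suff : eps * B <= s by lra.
rewrite -(ler_pM2l B0).
have rB : B <= r by rewrite /B; lra.
have : B ^+ 2 <= r ^+ 2 by rewrite ler_pXn2r// nnegrE; lra.
move=> h3; have h4 := le_trans h3 h1.
have := ler_wpM2l (ltW e0) h4; have := ler_wpM2r s0 h2; rewrite !expr2; lra.
Qed.

Lemma regular_bound (z : R) : regular z -> exists2 C : R, 0 < C &
  forall x f, form_graph x f ->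
    b (iota x) (iota x) <= C * b (f - z *: iota x) (f - z *: iota x).
Proof.
move=> [inj [C CP]]; exists (`|C| + 1); first by rewrite ltr_wpDl.
move=> x f xf; have [Dx Hf _] := xf; have Hr := Hsub z Dx Hf.
have [x' [k [xk n0 le_C]]] := CP _ Hr; have [Dx' Hk _] := xk.
have xx : null (iota x' - iota x).
  have := form_graph_lin (-1) xf xk; rewrite !scaleN1r !(addrC (- _)) => d.
  rewrite -iB; apply: inj d _; rewrite iB scalerBr.
  by have -> : k - f - (z *: iota x' - z *: iota x) =
    k - z *: iota x' - (f - z *: iota x) 
    by rewrite !opprB [LHS]addrACA [RHS]addrACA [- f + _]addrC.
rewrite -(si_null_eq Hb (iH Dx') (iH Dx) xx); apply: (le_trans le_C).
by rewrite ler_wpM2r ?(si_ge0 Hb)// (le_trans (ler_norm C))// lerDl.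
Qed.

(** If [z - c] and [z + c] are both regular then [(L - z)^2 - c^2], the
    product of two invertible operators, cannot be nonnegative with infimum 0:
    a lower bound [c ^+ 2] for [(L - z)^2] improves. *)
Lemma bounded_below_improve (z c : R) : 0 <= c ->
  regular (z - c) -> regular (z + c) -> bounded_below z (c ^+ 2) ->
  exists2 d : R, 0 < d & bounded_below z (c ^+ 2 + d).
Proof.
move=> c0 Rm Rp bb.
have [C1 C10 C1P] := regular_bound Rp.
have [_ [C2' C2P]] := Rm.
pose C2 := `|C2'|; have C20 : 0 <= C2 by exact: normr_ge0.
pose K := 1 + c * (C2 + 1).
have K0 : 0 < K by have := mulr_ge0 c0 C20; rewrite /K; lra.
have CK : 0 < C1 * K by rewrite mulr_gt0.
exists (C1 * K)^-1; first by rewrite invr_gt0.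
move=> x f xf; have [Dx Hf _] := xf.
set P := f - (z + c) *: iota x.
have HP : H P by exact: Hsub.
have [y [k [yk n0 yC]]] := C2P _ HP; have [Dy Hk _] := yk.
(* the nonnegative symmetric form <(L - z - c) x, (L - z + c) y> *)
pose p x f y g := b (f - z *: iota x) (g - z *: iota y)
                  - c ^+ 2 * b (iota x) (iota y).
have pxy : p x f y k = b P (k - (z - c) *: iota y).
  have := form_graph_sym xf yk; rewrite /p /P.
  rewrite !(siBl Hb)// !(siBr Hb)// !(siZl Hb)// !(siZr Hb)// => ->.
  rewrite (si_sym Hb (iH Dx) Hk); ring.
have pyy : p y k y k = b (k - (z + c) *: iota y) (k - (z - c) *: iota y).
  rewrite /p !(siBl Hb)// !(siBr Hb)// !(siZl Hb)// !(siZr Hb)//.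
  rewrite (si_sym Hb (iH Dy) Hk); ring.
have CS : p x f y k ^+ 2 <= p x f x f * p y k y k.
  have pyy0 : 0 <= p y k y k by rewrite /p subr_ge0; exact: bb.
  apply: quad_disc => // t.
  have := bb _ _ (form_graph_lin t yk xf).
  rewrite -subr_ge0 iD iZ.
  have -> : t *: k + f - z *: (t *: iota y + iota x) =
     (f - z *: iota x) + t *: (k - z *: iota y).
    by rewrite scalerDr scalerBr opprD addrACA addrC !scalerA (mulrC t).
  have Hfx := Hsub z Dx Hf; have Hky := Hsub z Dy Hk.
  rewrite [t *: iota y + _]addrC (si_sqD Hb Hfx (siZ_closed Hb t Hky)).
  rewrite (si_sqD Hb (iH Dx) (siZ_closed Hb t (iH Dy))).
  rewrite (si_sqZ Hb _ Hky) (si_sqZ Hb _ (iH Dy)).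
  rewrite (siZr Hb _ Hky Hfx) (siZr Hb _ (iH Dy) (iH Dx)) /p.
  by congr (0 <= _); ring.
have E1 : p x f y k = b P P.
  rewrite pxy (si_sym Hb)// (si_null_sub Hb (Hsub _ Dy Hk) HP HP n0)//.
have E2 : p y k y k <= K * b P P.
  rewrite pyy (si_sym Hb)// (si_null_sub Hb (Hsub _ Dy Hk) HP _ n0)//.
  have -> : k - (z + c) *: iota y = (k - (z - c) *: iota y) - (2 * c) *: iota y.
    by rewrite -addrA -opprD -scalerDl; congr (_ - _ *: _); ring.
  rewrite (siBr Hb)// (siZr Hb)// (si_sym Hb)//.
  rewrite (si_null_sub Hb (Hsub _ Dy Hk) HP HP n0).
  have := si_ge0 Hb (siD_closed Hb HP (iH Dy)); rewrite (si_sqD Hb)//.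
  have : b (iota y) (iota y) <= C2 * b P P.
    by apply: (le_trans yC); rewrite ler_wpM2r ?(si_ge0 Hb)// ler_norm.
  rewrite /K; move: (b P P) (b P _) (b _ _) => r s t h1 h2.
  have := ler_wpM2l c0 h1; have := mulr_ge0 c0 h2; lra.
have P0 := si_ge0 Hb HP.
have pxx : 0 <= p x f x f by rewrite /p subr_ge0 bb.
have E3 : b P P <= K * p x f x f.
  have [P1|P1] := eqVneq (b P P) 0.
    by rewrite P1 mulr_ge0// ltW.
  have {P1}P1 : 0 < b P P by rewrite lt_def P1.
  rewrite -(ler_pM2r P1) -expr2 -E1 (le_trans CS)// E1.
  by rewrite [K * _]mulrC -mulrA ler_wpM2l.
have := C1P _ _ xf; rewrite -/P => h.
have {}h : b (iota x) (iota x) <= C1 * K * p x f x f.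
  by apply: (le_trans h); rewrite -mulrA ler_pM2l.
rewrite mulrDl -lerBrDl mulrC ler_pdivrMr// mulrC.
exact: h.
Qed.

(** At the midpoint z of ]0, eps[ the best lower bound t of |(L - z) x|^2 is at
    least z^2, since otherwise z - sqrt t and z + sqrt t are both regular and t
    improves.  Expanding |(L - z) x|^2 >= z^2 |x|^2 gives L^2 >= 2 z L. *)
Lemma regular_operator_gap (eps : R) : 0 < eps ->
  (forall z, 0 < z -> z < eps -> regular z) -> operator_gap eps.
Proof.
move=> e0 reg.
pose z := eps / 2.
have z0 : 0 < z by rewrite /z; lra.
suff bb : bounded_below z (z ^+ 2).
  move=> x f xf; have := bb _ _ xf; have [Dx Hf _] := xf.
  rewrite (si_sqB Hb)// (siZr Hb)// (si_sqZ Hb)// -(form_graph_sq xf).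
  have -> : eps = 2 * z by rewrite /z; field.
  by lra.
pose S := [set t : R | 0 <= t <= z ^+ 2 /\ bounded_below z t].
have S0 : S 0.
  by split; [rewrite lexx sqr_ge0|move=> x f [Dx Hf _]; rewrite mul0r (si_ge0 Hb)].
have supS : has_sup S.
  by split; [exists 0|exists (z ^+ 2) => t [/andP[]]].
pose t := sup S.
have t0 : 0 <= t by apply: ub_le_sup => //; case: supS.
have tz : t <= z ^+ 2 by apply: ge_sup => [|u [/andP[]]//]; exists 0.
have tbb : bounded_below z t.
  move=> x f xf; have [Dx Hf _] := xf.
  have [x0|x0] := eqVneq (b (iota x) (iota x)) 0.
    by rewrite x0 mulr0 (si_ge0 Hb).
  have {}x0 : 0 < b (iota x) (iota x) by rewrite lt_def x0 (si_ge0 Hb).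
  rewrite -ler_pdivlMr//; apply: ge_sup; first by exists 0.
  by move=> u [_ ubb]; rewrite ler_pdivlMr//; exact: ubb.
have [->//|tz1] := eqVneq (z ^+ 2) t.
have {tz1}tz : t < z ^+ 2 by rewrite lt_def tz1.
pose c := Num.sqrt t.
have c0 : 0 <= c by exact: sqrtr_ge0.
have ct : c ^+ 2 = t by rewrite sqr_sqrtr.
have cz : c < z.
  by rewrite -(@ltr_pXn2r _ 2)// ?nnegrE ?ltW// ct.
have ze : z + z = eps by rewrite /z; field.
have [|||d d0] := @bounded_below_improve z c c0; rewrite ?ct//.
- by apply: reg; lra.
- by apply: reg; lra.
move=> dbb; pose t' := Order.min (t + d) (z ^+ 2).
have t't : t < t' by rewrite lt_min tz ltrDl d0.
suff : t' <= t by rewrite leNgt t't.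
apply: ub_le_sup; first by case: supS.
split; first by rewrite (ltW (le_lt_trans t0 t't)) ge_min lexx orbT.
move=> x f xf; apply: le_trans (dbb _ _ xf).
have [Dx _ _] := xf.
by rewrite ler_wpM2r ?(si_ge0 Hb) ?ge_min ?lexx//; exact: iH.
Qed.

(** The variational characterisation of the bottom of the nonzero spectrum. *)
Lemma energy_gapP (eps : R) : 0 < eps ->
  energy_gap eps <-> (forall z, z != 0 -> z < eps -> regular z).
Proof.
move=> e0; split=> [gap z z0 ze|reg].
  have [zn|zp] := ltP z 0; first exact: regular_neg.
  by apply: energy_gap_regular ze gap; rewrite lt_def z0.
apply: operator_gap_energy => //; apply: regular_operator_gap => // z z0 ze.
by apply: reg => //; rewrite gt_eqF.
Qed.

End FormOperator.

Section GapComparison.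
Context (R : realType) (V W : lmodType R) (D : set W).
Context (iota : W -> V) (b b' : V -> V -> R) (q q' : W -> W -> R).

(** The condition is transported with the same vector of small energy, the error
    allowed for the first form being divided by [a]. *)
Lemma energy_gap_le (a c eps : R) : 1 <= a -> 0 < c -> 0 <= eps ->
  (forall x y, D x -> D y -> D (x - y)) ->
  (forall x, D x -> q x x <= a * q' x x) ->
  (forall x, D x -> q' x x <= a * q x x) ->
  (forall x, D x -> b' (iota x) (iota x) <= c * b (iota x) (iota x)) ->
  energy_gap D iota b q eps -> energy_gap D iota b' q' (eps / (a * c)).
Proof.
move=> a1 c0 e0 DB qq' q'q b'b gap w Dw eta eta0.
have a0 : 0 < a by lra.
have [v [Dv qv gv]] := gap w Dw _ (divr_gt0 eta0 a0).
exists v; split=> //.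
  by apply: (le_trans (q'q _ Dv)); rewrite mulrC -ler_pdivlMr.
have := ler_wpM2l e0 (b'b _ (DB _ _ Dw Dv)).
rewrite [eps / _ * _]mulrAC ler_pdivrMr ?mulr_gt0// => /le_trans; apply.
rewrite mulrCA mulrA [leRHS]mulrC [a * c]mulrC -!mulrA ler_pM2l//.
apply: (le_trans gv); rewrite mulrDr; apply: lerD; first exact: qq'.
rewrite ler_pdivrMr// mulrAC -[leLHS]mul1r ler_pM2r//.
by apply: (le_trans a1); rewrite ler_peMr// ltW.
Qed.

End GapComparison.

(** * Weighted L2 spaces of a finite Borel measure *)

Lemma continuous_borel (R : realType) (T : ptopologicalType) (f : T -> R) :
  continuous f -> measurable_fun [set: borel T] (f : borel T -> R).
Proof.
move=> fc; apply: (measurability _ (RGenOpens.measurableE R)).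
move=> _ [_ [x [y ->]] <-]; rewrite setTI; apply: sub_sigma_algebra.
by apply: open_comp => // ? _; exact: fc.
Qed.

Section L2Theory.
Context (R : realType) (M : ptopologicalType).
Context (vol : {measure set (borel M) -> \bar R}).

(** The densities for which the weighted L^2 spaces coincide as vector spaces, with
    equivalent norms. *)
Definition bounded_weight (w : M -> R) : Prop :=
  measurable_fun [set: borel M] (w : borel M -> R) /\
  exists c C : R, 0 < c /\ forall x, c <= w x <= C.

Hypothesis vol_fin : (vol setT < +oo)%E.

Lemma weight_gt0 w : bounded_weight w -> forall x, 0 < w x.
Proof.
by move=> [_ [c [C [c0 cw]]]] x; case/andP: (cw x) => cx _; exact: lt_le_trans cx.
Qed.

Lemma weight_integrable w : bounded_weight w ->
  vol.-integrable [set: borel M] (EFin \o w).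
Proof.
move=> ww; have w0 := weight_gt0 ww; case: ww => mw [c [C [_ cC]]].
apply: measurable_bounded_integrable => //.
exists C; split; first exact: num_real.
move=> K CK x _ /=; rewrite gtr0_norm//.
by case/andP: (cC x) => _ wC; exact: (le_trans wC (ltW CK)).
Qed.

Lemma L2_mul_integrable w f k : bounded_weight w -> L2 vol w f -> L2 vol w k ->
  vol.-integrable [set: borel M] (EFin \o (fun x => f x * k x * w x)).
Proof.
move=> ww [mf fi] [mk ki]; have w0 := weight_gt0 ww; case: ww => mw _.
apply: (le_integrable _ _ _ (integrableD measurableT fi ki)) => //.
  by apply/measurable_EFinP; do 2 apply: measurable_funM => //.
move=> x _ /=; rewrite lee_fin.
have fk : `|f x * k x| <= f x ^+ 2 + k x ^+ 2.
  rewrite ler_norml; have := sqr_ge0 (f x + k x); have := sqr_ge0 (f x - k x).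
  have := sqr_ge0 (f x); have := sqr_ge0 (k x).
  by rewrite !expr2 => *; apply/andP; split; lra.
rewrite -mulrDl normrM (gtr0_norm (w0 x)).
rewrite [leRHS]ger0_norm; last by rewrite mulr_ge0 ?addr_ge0 ?sqr_ge0// ltW.
by rewrite ler_wpM2r// ltW.
Qed.

Lemma L2_weight w w' f : bounded_weight w -> bounded_weight w' ->
  L2 vol w f -> L2 vol w' f.
Proof.
move=> ww ww' [mf fi]; split=> //.
have w0 := weight_gt0 ww; have w'0 := weight_gt0 ww'.
case: ww => mw [c [C [c0 cC]]]; case: ww' => mw' [c' [C' [c'0 cC']]].
apply: (le_integrable _ _ _ (integrableZl measurableT (C' / c) fi)) => //.
  apply/measurable_EFinP; apply: measurable_funM => //.
  by apply: (measurable_funX 2).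
move=> x _ /=; rewrite lee_fin.
case/andP: (cC x) => h1 _; case/andP: (cC' x) => h3 h4.
have C'0 : 0 <= C' by exact: le_trans (ltW (w'0 x)) h4.
have fx := sqr_ge0 (f x); have wx := ltW (w0 x); have w'x := ltW (w'0 x).
have Cc : 0 <= C' / c by rewrite divr_ge0// ltW.
rewrite (ger0_norm (mulr_ge0 fx w'x)) (ger0_norm (mulr_ge0 Cc (mulr_ge0 fx wx))).
rewrite mulrCA ler_wpM2l//.
by rewrite mulrAC ler_pdivlMr// ler_pM// ltW.
Qed.

Lemma L2_lin w a u v : bounded_weight w -> L2 vol w u -> L2 vol w v ->
  L2 vol w (a *: u + v).
Proof.
move=> ww Lu Lv; split.
  by apply: measurable_funD; [apply: measurable_funM => //; case: Lu|case: Lv].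
have uu := L2_mul_integrable ww Lu Lu; have uv := L2_mul_integrable ww Lu Lv.
have vv := L2_mul_integrable ww Lv Lv.
apply: eq_integrable (integrableD measurableT
  (integrableD measurableT (integrableZl measurableT (a ^+ 2) uu)
     (integrableZl measurableT (2 * a) uv)) vv) => // x _ /=.
rewrite -!EFinM -!EFinD; congr (_%:E).
by have -> : (a *: u + v) x = a * u x + v x by []; ring.
Qed.

Lemma L2_inner_semi w : bounded_weight w ->
  semi_inner [set f | L2 vol w f] (L2_inner vol w).
Proof.
move=> ww; have w0 := weight_gt0 ww; split.
- split; first exact: measurable_cst.
  apply: eq_integrable (integrable0 _ _) => // x _ /=.
  by rewrite expr0n mul0r.
- by move=> a u v; exact: L2_lin.
- by move=> u v _ _; apply: eq_Rintegral => x _; rewrite (mulrC (u x)).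
- move=> a u v k /= Lu Lv Lk.
  have uk := L2_mul_integrable ww Lu Lk; have vk := L2_mul_integrable ww Lv Lk.
  rewrite /L2_inner -RintegralZl// -RintegralD//; last exact: (integrableZl _ a uk).
  apply: eq_Rintegral => x _.
  by have -> : (a *: u + v) x = a * u x + v x by []; ring.
- move=> u Lu; apply: Rintegral_ge0 => x _.
  by rewrite -expr2 mulr_ge0 ?sqr_ge0// ltW.
Qed.

Lemma L2_innerE w u : bounded_weight w -> L2 vol w u ->
  (L2_inner vol w u u)%:E = (\int[vol]_x (u x ^+ 2 * w x)%:E)%E.
Proof.
move=> ww Lu; rewrite fineK; last first.
  by apply: integrable_fin_num => //; exact: (L2_mul_integrable ww).
by apply: eq_integral => x _; rewrite expr2.
Qed.

Lemma L2_inner_null w u : bounded_weight w -> L2 vol w u ->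
  L2_inner vol w u u = 0 <-> u = (fun=> 0) %[ae vol].
Proof.
move=> ww Lu; have w0 := weight_gt0 ww.
have mu : measurable_fun [set: borel M] (fun x => (u x ^+ 2 * w x)%:E).
  by case: Lu => _ /integrableP[].
have abs : (\int[vol]_x (u x ^+ 2 * w x)%:E = \int[vol]_x `|(u x ^+ 2 * w x)%:E|)%E.
  apply: eq_integral => x _; rewrite abse_EFin ger0_norm//.
  by rewrite mulr_ge0 ?sqr_ge0// ltW.
have P := ae_eq_integral_abs vol measurableT mu; rewrite -abs -L2_innerE// in P.
split=> [u0|u0].
  have [+ _] := P; rewrite u0 => /(_ erefl); apply: filterS => x /(_ Logic.I).
  move=> [] /eqP; rewrite mulf_eq0 sqrf_eq0 (gt_eqF (w0 x)) orbF => /eqP ux _.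
  exact: ux.
have [_ h] := P; apply: EFin_inj; apply: h.
apply: (@filterS (borel M) _ _ _ _ _ u0) => x /(_ Logic.I) ux _.
by rewrite ux expr0n mul0r.
Qed.

Lemma L2_inner_le w w' (C : R) u : bounded_weight w -> bounded_weight w' ->
  (forall x, w' x <= C * w x) -> L2 vol w u ->
  L2_inner vol w' u u <= C * L2_inner vol w u u.
Proof.
move=> ww ww' wC Lu; have Lu' := L2_weight ww ww' Lu.
have i := L2_mul_integrable ww Lu Lu; have i' := L2_mul_integrable ww' Lu' Lu'.
rewrite /L2_inner -RintegralZl//; apply: le_Rintegral => //.
  exact: (integrableZl _ C i).
by move=> x _; rewrite mulrCA ler_wpM2l// -expr2 sqr_ge0.
Qed.

End L2Theory.

Section L2Complete.
Context (R : realType) (M : ptopologicalType).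
Context (vol : {measure set (borel M) -> \bar R}).
Hypothesis vol_fin : (vol setT < +oo)%E.
Local Notation ipL2 := (L2_inner vol).

(** By monotone convergence the sum of the increments has a finite integral, hence
    is finite almost everywhere. *)
Lemma L2_geometric_cvg w (g : nat -> M -> R) : bounded_weight w ->
  (forall k, L2 vol w (g k)) ->
  (forall k, ipL2 w (g k.+1 - g k) (g k.+1 - g k) < (2 ^ k)%:R ^- 2) ->
  {ae vol, forall x, cvgn (fun k => g k x)}.
Proof.
move=> ww Lg gd; have w0 := weight_gt0 ww.
have Lw := L2_inner_semi vol ww.
pose d k x := g k.+1 x - g k x.
have Ld k : L2 vol w (g k.+1 - g k) by apply: (siB_closed Lw); exact: Lg.
have mw : measurable_fun [set: borel M] (w : borel M -> R) by case: ww.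
have md k : measurable_fun [set: borel M] (d k : borel M -> R) by case: (Ld k).
have mdw k : measurable_fun [set: borel M] (fun x : borel M => (`|d k x| * w x)%:E).
  by apply/measurable_EFinP; apply: measurable_funM => //; exact: measurableT_comp.
have dw0 k x : (0 <= (`|d k x| * w x)%:E)%E.
  by rewrite lee_fin mulr_ge0// ltW.
have iw := weight_integrable vol_fin ww.
pose W := \int[vol]_x w x.
(* 2 |d| <= 2^k d^2 + 2^(-k) *)
have dk k : (\int[vol]_x (`|d k x| * w x)%:E <= ((1 + W) / (2 ^ (k + 1))%:R)%:E)%E.
  pose t : R := (2 ^ k)%:R; have t0 : 0 < t by rewrite ltr0n expn_gt0.
  have ti : 0 < t^-1 by rewrite invr_gt0.
  have id2 := L2_mul_integrable ww (Ld k) (Ld k).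
  have i1 := integrableZl measurableT (t / 2) id2.
  have i2 := integrableZl measurableT (t^-1 / 2) iw.
  have le1 x : `|d k x| * w x <=
      t / 2 * (d k x * d k x * w x) + t^-1 / 2 * w x.
    have -> : t / 2 * (d k x * d k x * w x) + t^-1 / 2 * w x =
      (t / 2 * `|d k x| ^+ 2 + t^-1 / 2) * w x.
      by rewrite real_normK ?num_real//; ring.
    rewrite ler_pM2r//; move: (`|d k x|) => a.
    rewrite -(ler_pM2l t0).
    have -> : t * (t / 2 * a ^+ 2 + t^-1 / 2) = (t ^+ 2 * a ^+ 2 + 1) / 2.
      by field; rewrite gt_eqF.
    by have := sqr_ge0 (t * a - 1); rewrite !expr2; lra.
  apply: (@le_trans _ _ (\int[vol]_x
      ((t / 2)%:E * (d k x * d k x * w x)%:E + (t^-1 / 2)%:E * (w x)%:E))%E).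
    apply: ge0_le_integral => //.
      by case/integrableP: (integrableD measurableT i1 i2).
    by move=> x _; rewrite -!EFinM -EFinD lee_fin.
  rewrite integralD// !integralZl//.
  have -> : (\int[vol]_x (w x)%:E = W%:E)%E.
    by rewrite fineK//; exact: integrable_fin_num.
  have -> : (\int[vol]_x (d k x * d k x * w x)%:E =
      (ipL2 w (g k.+1 - g k) (g k.+1 - g k))%:E)%E.
    by rewrite fineK//; exact: integrable_fin_num.
  rewrite -!EFinM -EFinD lee_fin.
  have := gd k; rewrite -/t; move: (L2_inner _ _ _ _) => I It.
  rewrite expnD natrM -/t expn1 invfM.
  have : t / 2 * I <= t / 2 * (t ^- 2) by rewrite ler_pM2l ?ltW// divr_gt0.
  have -> : t / 2 * t ^- 2 = t^-1 / 2 by field; rewrite gt_eqF.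
  by move=> h; lra.
pose S x := (\sum_(0 <= k <oo) (`|d k x| * w x)%:E)%E.
have mS : measurable_fun [set: borel M] (S : borel M -> \bar R).
  by apply: ge0_emeasurable_sum.
have S0 x : (0 <= S x)%E by apply: nneseries_ge0.
have iS : vol.-integrable [set: borel M] S.
  apply/integrableP; split=> //.
  under eq_integral do rewrite gee0_abs//.
  rewrite integral_nneseries//.
  apply: (@le_lt_trans _ _ (\sum_(0 <= k <oo) ((1 + W) / (2 ^ (k + 1))%:R)%:E)%E).
    by apply: lee_nneseries => // k _ _; apply: integral_ge0 => x _; exact: dw0.
  by rewrite (cvg_lim _ (@cvg_geometric_eseries_half R (1 + W) 0))// ltry.
have := integrable_ae measurableT iS; apply: filterS => x /(_ Logic.I) Sx.
have ndw k : \sum_(0 <= i < k) `|d i x| <= fine (S x) / w x.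
  rewrite ler_pdivlMr// mulr_suml -lee_fin fineK// -sumEFin.
  by apply: nneseries_lim_ge.
have cd : cvgn (series (d ^~ x)).
  apply: normed_cvg; apply: nondecreasing_is_cvgn.
    by apply: nondecreasing_series => k _ _; exact: normr_ge0.
  by exists (fine (S x) / w x) => _ [k _ <-]; exact: ndw.
have -> : (fun k => g k x) = (fun k => g 0%N x + series (d ^~ x) k).
  apply/funext => k; rewrite /series /= telescope_sumr//.
  by rewrite addrC subrK.
by apply: is_cvgD => //; exact: is_cvg_cst.
Qed.

(** The Riesz-Fischer theorem: a subsequence converges almost everywhere, and
    Fatou's lemma turns this into convergence in the norm. *)
Lemma L2_complete w : bounded_weight w ->
  si_complete [set f | L2 vol w f] (ipL2 w).
Proof.
move=> ww f Lf fC; have w0 := weight_gt0 ww; have Lw := L2_inner_semi vol ww.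
have mw : measurable_fun [set: borel M] (w : borel M -> R) by case: ww.
have p2 k : (0 : R) < (2 ^ k)%:R ^- 2 by rewrite invr_gt0 exprn_gt0// ltr0n expn_gt0.
have /choice[N NP] k := fC _ (p2 k).
pose phi k := (\sum_(j < k.+1) N j)%N.
have phiS k : (phi k <= phi k.+1)%N by rewrite /phi [leqRHS]big_ord_recr leq_addr.
have Nphi k : (N k <= phi k)%N by rewrite /phi big_ord_recr leq_addl.
pose g k := f (phi k + k)%N.
have Lg k : L2 vol w (g k) by exact: Lf.
have gd k : ipL2 w (g k.+1 - g k) (g k.+1 - g k) < (2 ^ k)%:R ^- 2.
  apply: NP; first by rewrite (leq_trans (Nphi k))// (leq_trans (phiS k))// leq_addr.
  by rewrite (leq_trans (Nphi k))// leq_addr.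
have gae := L2_geometric_cvg ww Lg gd.
pose u x := fine (limn_esup (fun k => (g k x)%:E)).
have mg k : measurable_fun [set: borel M] (g k : borel M -> R) by case: (Lg k).
have mu : measurable_fun [set: borel M] (u : borel M -> R).
  apply: measurableT_comp => //; apply: measurable_fun_limn_esup => k.
  exact/measurable_EFinP.
have ucvg : {ae vol, forall x, g k x @[k --> \oo] --> u x}.
  apply: (@filterS (borel M) _ _ _ _ _ gae) => x /cvg_ex[l gl].
  have gl' : (g k x)%:E @[k --> \oo] --> l%:E 
    by apply: cvg_EFin => //; exact: nearW.
  by rewrite /u (cvg_limn_einf_sup gl').2.
(* Fatou for the squared distance to a fixed function *)
have key v (e : R) L : L2 vol w v ->
    (forall l, (L <= l)%N -> ipL2 w (v - g l) (v - g l) <= e) ->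
    (\int[vol]_x ((v x - u x) ^+ 2 * w x)%:E <= e%:E)%E.
  move=> Lv ve; have mv : measurable_fun [set: borel M] (v : borel M -> R) by case: Lv.
  pose F l (x : borel M) := ((v x - g (l + L)%N x) ^+ 2 * w x)%:E.
  have mF l : measurable_fun [set: borel M] (F l).
    apply/measurable_EFinP; apply: measurable_funM => //.
    by apply: (measurable_funX 2); exact: measurable_funB.
  have F0 l x : (0 <= F l x)%E by rewrite lee_fin mulr_ge0 ?sqr_ge0// ltW.
  apply: (@le_trans _ _ (\int[vol]_x limn_einf (F ^~ x))%E).
    apply: ae_ge0_le_integral => //.
    - by move=> x _; rewrite lee_fin mulr_ge0 ?sqr_ge0// ltW.
    - apply/measurable_EFinP; apply: measurable_funM => //.
      by apply: (measurable_funX 2); exact: measurable_funB.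
    - move=> x _; rewrite limn_einf_lim; apply: lime_ge; first exact: is_cvg_einfs.
      by apply: nearW => l; apply: le_ereal_inf_tmp => _ [k _ <-].
    - have -> : (fun x => limn_einf (F ^~ x)) =
          (fun x => - limn_esup (fun l => - F l x)%E)%E.
        by apply/funext => x; rewrite (limn_esupN (F ^~ x)) oppeK.
      apply: measurableT_comp => //; apply: measurable_fun_limn_esup => l.
      exact: measurableT_comp.
    apply: (@filterS (borel M) _ _ _ _ _ ucvg) => x gx _.
    have Fx : F ^~ x @ \oo --> ((v x - u x) ^+ 2 * w x)%:E.
      have h : v x - g (l + L)%N x @[l --> \oo] --> v x - u x.
        apply: cvgB; first exact: cvg_cst.
        by rewrite (cvg_shiftn L (fun k => g k x)).
      apply: cvg_EFin; first exact: nearW.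
      by apply: cvgM; [exact: (cvgM h h)|exact: cvg_cst].
    by rewrite (cvg_limn_einf_sup Fx).1.
  apply: (le_trans (fatou vol measurableT mF (fun l x _ => F0 l x))).
  rewrite limn_einf_lim; apply: lime_le; first exact: is_cvg_einfs.
  apply: nearW => l; apply: (@le_trans _ _ (\int[vol]_x F l x)%E).
    by apply: ereal_inf_lbound; exists l => /=.
  have Lvg : L2 vol w (v - g (l + L)%N) by apply: (siB_closed Lw) => //; exact: Lg.
  by rewrite -(L2_innerE ww Lvg) lee_fin ve// leq_addl.
have Lu : L2 vol w u.
  have Lk : L2 vol w (f (N 0%N) - u).
    have mv : measurable_fun [set: borel M] (f (N 0%N) : borel M -> R).
      by case: (Lf (N 0%N)).
    have mvu := measurable_funB mv mu; split=> //; apply/integrableP; split.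
      apply/measurable_EFinP; apply: measurable_funM => //.
      exact: (measurable_funX 2).
    apply: le_lt_trans (ltry ((2 ^ 0)%:R ^- 2 : R)).
    under eq_integral => x _.
      rewrite gee0_abs; last by rewrite lee_fin mulr_ge0 ?sqr_ge0 ?ltW.
      over.
    apply: (key _ _ 0%N) => [|l _]; first exact: Lf.
    apply: ltW; apply: NP => //; apply: leq_trans (Nphi 0%N) _.
    rewrite (leq_trans _ (leq_addr _ _))//; elim: l => // l IH.
    exact: leq_trans IH (phiS l).
  have -> : u = f (N 0%N) - (f (N 0%N) - u) by rewrite opprB addrC subrK.
  by apply: (siB_closed Lw) => //; exact: Lf.
exists u => // e e0.
have [K KP] := fC (e / 2) ltac:(lra).
exists K => k Kk.
have : (\int[vol]_x ((f k x - u x) ^+ 2 * w x)%:E <= (e / 2)%:E)%E.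
  apply: (key _ _ K); first exact: Lf.
  move=> l Kl; apply: ltW; apply: KP => //.
  by rewrite (leq_trans Kl)// leq_addl.
have Lk : L2 vol w (f k - u) by apply: (siB_closed Lw) => //; exact: Lf.
by rewrite -(L2_innerE ww Lk) lee_fin; lra.
Qed.

End L2Complete.

(** * Integrals of arbitrary nonnegative functions *)

Section NonmeasurableIntegral.
Import HBNNSimple.
Local Open Scope ereal_scope.
Context (R : realType) (d : measure_display) (T : measurableType d).
Context (mu : {measure set T -> \bar R}).

(** The integral of a nonnegative function, measurable or not, is the supremum of
    the integrals of the simple functions below it. *)
Lemma ge0_le_integralT (f g : T -> \bar R) : (forall x, 0 <= f x) ->
  (forall x, f x <= g x) -> \int[mu]_x f x <= \int[mu]_x g x.
Proof.
move=> f0 fg; have g0 x : 0 <= g x by exact: le_trans (fg x).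
rewrite !ge0_integralTE//; apply: le_ereal_sup => _ [k kf <-]; exists k => // x.
exact: le_trans (kf x) (fg x).
Qed.

(** A simple function below [f], once set to 0 on the exceptional set and divided
    by [a], is a simple function below [g]. *)
Lemma ae_le_integralZ (a : R) (f g : T -> R) : (0 < a)%R ->
  (forall x, 0 <= f x)%R -> (forall x, 0 <= g x)%R ->
  {ae mu, forall x, f x <= a * g x}%R ->
  \int[mu]_x (f x)%:E <= a%:E * \int[mu]_x (g x)%:E.
Proof.
move=> a0 f0 g0 [N [mN N0 NP]].
rewrite ge0_integralTE; last by move=> x; rewrite lee_fin.
apply: ge_ereal_sup => _ [k /= kf <-]; rewrite -integralT_nnsfun.
have k0 x : (0 <= k x)%R by exact: fun_ge0.
pose k' x := (a^-1 * (k x * \1_(~` N) x))%R.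
have mk : measurable_fun setT k by exact: measurable_funP.
have mk1 : measurable_fun setT (fun x => k x * \1_(~` N) x)%R.
  by apply: measurable_funM => //; apply: measurable_indic; exact: measurableC.
have k10 x : (0 <= k x * \1_(~` N) x)%R by rewrite mulr_ge0.
have -> : \int[mu]_x (k x)%:E = \int[mu]_x (k x * \1_(~` N) x)%:E.
  apply: ge0_ae_eq_integral => //; try exact/measurable_EFinP.
  - by move=> x _; rewrite lee_fin.
  - by move=> x _; rewrite lee_fin.
  exists N; split=> // x /= h; apply: contrapT => Nx; apply: h => _.
  by rewrite indicE mem_set// mulr1.
have -> : \int[mu]_x (k x * \1_(~` N) x)%:E = a%:E * \int[mu]_x (k' x)%:E.
  rewrite -ge0_integralZl//.
  - by apply: eq_integral => x _; rewrite -EFinM mulrA divff ?gt_eqF// mul1r.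
  - by apply/measurable_EFinP; exact: measurable_funM.
  - by move=> x _; rewrite lee_fin mulr_ge0// invr_ge0 ltW.
  - by rewrite lee_fin ltW.
rewrite lee_pmul2l//; apply: ge0_le_integralT => x; rewrite lee_fin.
  by rewrite mulr_ge0// invr_ge0 ltW.
rewrite /k' ler_pdivrMl// indicE; have [|] := boolP (x \in ~` N).
  rewrite inE => Nx; rewrite mulr1.
  have := kf x; rewrite lee_fin => /le_trans; apply.
  by apply: contrapT => h; exact: Nx (NP _ h).
by rewrite mulr0 mulr_ge0// ltW.
Qed.

End NonmeasurableIntegral.

Section IteratedIntegral.
Local Open Scope ereal_scope.
Context (R : realType).

Lemma integral_rV_ge0 n (f : 'rV[R]_n -> \bar R) :
  (forall y, 0 <= f y) -> 0 <= integral_rV f.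
Proof.
elim: n f => [|n IH] f f0 /=; first exact: f0.
by apply: integral_ge0 => t _; apply: IH.
Qed.

(** The inner integral over the last coordinates is bounded by a multiple of the
    indicator of an interval, whatever its measurability. *)
Lemma integral_rV_le n (f : 'rV[R]_n -> \bar R) (r C : R) :
  (0 <= r)%R -> (0 <= C)%R -> (forall y, 0 <= f y <= C%:E) ->
  (forall y, f y != 0 -> forall k, `|y 0 k| <= r)%R ->
  integral_rV f <= (C * (2 * r) ^+ n)%:E.
Proof.
elim: n C f => [|n IH] C f r0 C0 fC fr /=.
  by rewrite expr0 mulr1; case/andP: (fC 0%R).
have row_mxE1 (t : R) (y : 'rV[R]_n) :
    (row_mx (const_mx t : 'rV[R]_1) y : 'rV_n.+1) 0%R (lshift n (ord0 : 'I_1)) = t.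
  by rewrite /= (row_mxEl (const_mx t : 'rV[R]_1)) mxE.
have row_mxE2 (t : R) (y : 'rV[R]_n) k :
    (row_mx (const_mx t : 'rV[R]_1) y : 'rV_n.+1) 0%R (rshift 1 k : 'I_n.+1) = y 0%R k.
  by rewrite (row_mxEr (const_mx t : 'rV[R]_1)).
pose g (t : R) y := f (row_mx (const_mx t : 'rV[R]_1) y).
have gt0 (t : R) : ~~ (`|t| <= r)%R -> integral_rV (g t) = 0.
  move=> tr; apply/eqP; rewrite eq_le integral_rV_ge0 ?andbT; last first.
    by move=> y; case/andP: (fC (row_mx (const_mx t : 'rV[R]_1) y)).
  have g0 y : g t y = 0.
    apply/eqP; apply: contraNT tr => /fr/(_ (lshift n (ord0 : 'I_1))).
    by rewrite (row_mxE1 t y).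
  by have := IH 0%R (g t) r0 (lexx _); rewrite mul0r; apply=> y; rewrite g0 ?lexx ?eqxx.
have gr (t : R) : integral_rV (g t) <= (C * (2 * r) ^+ n)%:E.
  apply: IH => // y; first exact: fC.
  by move=> /fr h k; have := h (rshift 1 k : 'I_n.+1); rewrite (row_mxE2 t y).
have K0 : (0 <= C * (2 * r) ^+ n)%R by rewrite mulr_ge0// exprn_ge0// mulr_ge0.
apply: (@le_trans _ _ (\int[@lebesgue_measure R]_t
    ((C * (2 * r) ^+ n)%:E * (\1_`[(- r)%R, r] t)%:E))).
  apply: ge0_le_integralT => t.
    by apply: integral_rV_ge0 => y; case/andP: (fC (row_mx (const_mx t : 'rV[R]_1) y)).
  rewrite indicE; have [|] := boolP (t \in _); first by rewrite mule1 => _; exact: gr.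
  rewrite notin_setE /= in_itv /= -ler_norml => /negP/gt0.
  by rewrite mule0 => h; rewrite -/(g t) h.
rewrite ge0_integralZl//; last by apply/measurable_EFinP; apply: measurable_indic.
have -> : \int[@lebesgue_measure R]_t (\1_`[(- r)%R, r] t)%:E =
    lebesgue_measure (`[(- r)%R, r] : set R) by rewrite integral_indic// setIT.
rewrite lebesgue_measure_itv /= lte_fin.
case: ifPn => [_|_].
  rewrite -EFinD -EFinM lee_fin le_eqVlt; apply/orP; left; apply/eqP.
  by rewrite exprS; ring.
by rewrite mule0 lee_fin mulr_ge0// exprn_ge0// mulr_ge0.
Qed.

End IteratedIntegral.

(** * Limits and derivatives of matrices and of real functions *)

Lemma cvgr0P (R : realType) (u : nat -> R) : (forall k, 0 <= u k) ->
  (u k @[k --> \oo] --> (0 : R)) <->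
  (forall e : R, 0 < e -> exists N, forall k, (N <= k)%N -> u k < e).
Proof.
move=> u0; split=> [uc e e0|uc].
  have /cvgrPdist_lt/(_ e e0)[N _ NP] := uc.
  by exists N => k /NP /=; rewrite sub0r normrN ger0_norm.
apply/cvgrPdist_lt => e e0; have [N NP] := uc e e0.
by exists N => // k /NP /=; rewrite sub0r normrN ger0_norm.
Qed.


Section Calculus.
Context (R : realType).

Lemma near_eq_differentiable (V W : normedModType R) (f g : V -> W) (x : V) :
  differentiable f x -> (\near x, f x = g x) -> differentiable g x.
Proof.
move=> /diff_locallyP[dfc dfx] fg.
have gx : g \o shift x = cst (g x) + 'd f x +o_ 0 id.
  apply/eqaddoP => eps eps0; have /eqaddoP/(_ _ eps0) := dfx.
  have : \forall h \near (0 : V), f (h + x) = g (h + x).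
    by have := fg; rewrite (near_shift 0) subr0.
  move=> fgh; apply: filterS2 fgh => h /= E.
  by rewrite !fctE /= E (nbhs_singleton fg).
apply/diff_locallyP; split; first by rewrite (diff_unique dfc gx).
by rewrite (diff_unique dfc gx).
Qed.

Lemma cvg_near_eq (T : Type) (F : set_system T) {FF : Filter F} (f g : T -> R)
    (l : R) :
  f x @[x --> F] --> l -> (\forall x \near F, f x = g x) -> g x @[x --> F] --> l.
Proof. by move=> fl fg; apply: cvg_trans fl; apply: near_eq_cvg. Qed.

Lemma cvg_sumr (T I : Type) (F : set_system T) {FF : Filter F} (r : seq I)
    (f : I -> T -> R) (a : I -> R) : (forall i, f i x @[x --> F] --> a i) ->
  \sum_(i <- r) f i x @[x --> F] --> \sum_(i <- r) a i.
Proof.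
move=> fa; elim: r => [|i r IH].
  by rewrite big_nil; under eq_cvg do rewrite big_nil; exact: cvg_cst.
rewrite big_cons; under eq_cvg do rewrite big_cons.
by apply: cvgD.
Qed.

Lemma cvg_prodr (T I : Type) (F : set_system T) {FF : Filter F} (r : seq I)
    (f : I -> T -> R) (a : I -> R) : (forall i, f i x @[x --> F] --> a i) ->
  \prod_(i <- r) f i x @[x --> F] --> \prod_(i <- r) a i.
Proof.
move=> fa; elim: r => [|i r IH].
  by rewrite big_nil; under eq_cvg do rewrite big_nil; exact: cvg_cst.
rewrite big_cons; under eq_cvg do rewrite big_cons.
by apply: cvgM.
Qed.

Lemma cvg_det n (T : Type) (F : set_system T) {FF : Filter F}
    (A : T -> 'M[R]_n) (B : 'M[R]_n) :
  (forall i j, A x i j @[x --> F] --> B i j) -> \det (A x) @[x --> F] --> \det B.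
Proof.
move=> AB; apply: cvg_sumr => s.
apply: cvgM; first exact: cvg_cst.
by apply: cvg_prodr => i; exact: AB.
Qed.

Lemma cvg_invmx n (T : Type) (F : set_system T) {FF : Filter F}
    (A : T -> 'M[R]_n) (B : 'M[R]_n) i j : B \in unitmx ->
  (forall i j, A x i j @[x --> F] --> B i j) ->
  invmx (A x) i j @[x --> F] --> invmx B i j.
Proof.
move=> uB AB; have dA : \det (A x) @[x --> F] --> \det B by exact: cvg_det.
have dB : \det B != 0 by rewrite -unitfE.
have dA0 : \forall x \near F, \det (A x) != 0 by exact: cvgr_neq0 dA dB.
rewrite /invmx uB mxE.
have h : (\det (A x))^-1 * \adj (A x) i j @[x --> F] --> (\det B)^-1 * \adj B i j.
  apply: cvgM; first exact: cvgV.
  rewrite mxE; under eq_cvg do rewrite mxE.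
  apply: cvgM; first exact: cvg_cst.
  by apply: cvg_det => k l; rewrite !mxE; under eq_cvg do rewrite !mxE; exact: AB.
apply: cvg_trans h; apply: near_eq_cvg.
by apply: filterS dA0 => x dx; rewrite unitmxE unitfE dx [RHS]mxE.
Qed.

Lemma cvg_mulmx (T : Type) (F : set_system T) {FF : Filter F} m n p
    (A : T -> 'M[R]_(m, n)) (A' : 'M[R]_(m, n))
    (B : T -> 'M[R]_(n, p)) (B' : 'M[R]_(n, p)) i k :
  (forall i j, A x i j @[x --> F] --> A' i j) ->
  (forall i j, B x i j @[x --> F] --> B' i j) ->
  (A x *m B x) i k @[x --> F] --> (A' *m B') i k.
Proof.
move=> AA BB; rewrite mxE; under eq_cvg do rewrite mxE.
apply: cvg_sumr => j.
by apply: cvgM; [exact: AA|exact: BB].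
Qed.

Section PositiveDefinite.
Context (n : nat) (G : 'M[R]_n).
Hypothesis Gsym : G^T = G.
Hypothesis Gpos : forall v : 'rV[R]_n, v != 0 -> 0 < (v *m G *m v^T) 0 0.

Lemma posdef_unitmx : G \in unitmx.
Proof.
rewrite -row_free_unit -kermx_eq0; apply/eqP/row_matrixP => i.
rewrite row0; apply/eqP; apply: contraT => v0.
have := Gpos v0; suff -> : row i (kermx G) *m G = 0 by rewrite mul0mx mxE ltxx.
by rewrite -row_mul mulmx_ker row0.
Qed.

Lemma posdef_inv_sym (u v : 'rV[R]_n) :
  (u *m invmx G *m v^T) 0 0 = (v *m invmx G *m u^T) 0 0.
Proof.
have -> : (v *m invmx G *m u^T) 0 0 = (v *m invmx G *m u^T)^T 0 0 by rewrite [RHS]mxE.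
by rewrite !trmx_mul trmxK trmx_inv Gsym mulmxA.
Qed.

(** Substituting v = u G turns the quadratic form of the inverse into that of G. *)
Lemma posdef_inv_ge0 (v : 'rV[R]_n) : 0 <= (v *m invmx G *m v^T) 0 0.
Proof.
set u := v *m invmx G.
have -> : v = u *m G by rewrite mulmxKV// posdef_unitmx.
rewrite trmx_mul Gsym mulmxA.
by have [->|/Gpos/ltW//] := eqVneq u 0; rewrite !mul0mx mxE.
Qed.

End PositiveDefinite.
End Calculus.

(** * Smooth functions and their gradients on a manifold *)

Section SmoothFunctions.
Context (R : realType) (n : nat) (M : ptopologicalType).
Context (X : smooth_atlas R n M).

Lemma near_open (T : topologicalType) (V : set T) (P : set T) x :
  open V -> V x -> (forall y, V y -> P y) -> \forall y \near x, P y.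
Proof. by move=> oV Vx VP; apply: filterS VP _; exact: open_nbhs_nbhs. Qed.

(** The derivatives of a linear combination are the combinations of the derivatives
    at the points of [V] only, hence the hypothesis on [u] is restricted to [V] for
    the induction on [k]. *)
Lemma Ck_on_lin (V : set 'rV[R]_n) k (a : R) (f f' u : 'rV[R]_n -> R) : open V ->
  Ck_on k V f -> Ck_on k V f' -> (forall x, V x -> u x = a * f x + f' x) ->
  Ck_on k V u.
Proof.
move=> oV; elim: k f f' u => [|k IH] f f' u /=.
  move=> fc f'c uE x Vx; change (u y @[y --> x] --> u x); rewrite (uE x Vx).
  have h : a * f y + f' y @[y --> x] --> a * f x + f' x.
    exact: (cvgD (cvgM (cvg_cst a) (fc x Vx)) (f'c x Vx)).
  apply: (cvg_near_eq h).
  by apply: (near_open oV Vx) => y Vy; rewrite uE.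
move=> [df Df] [df' Df'] uE.
have near_u x : V x -> \forall y \near x, (a *: f + f') y = u y.
  by move=> Vx; apply: (near_open oV Vx) => y Vy; rewrite uE.
split=> [x Vx|b].
  apply: near_eq_differentiable (near_u x Vx).
  apply: differentiableD; last exact: df'.
  by apply: differentiableZ; exact: df.
apply: (IH _ _ _ (Df b) (Df' b)) => x Vx.
rewrite -(near_eq_derive _ (near_u x Vx)).
have dx := diff_derivable (df x Vx); have dx' := diff_derivable (df' x Vx).
by rewrite deriveD ?deriveZ//; exact: derivableZ.
Qed.

Lemma smooth_lin (a : R) (f k : M -> R) :
  smooth X f -> smooth X k -> smooth X (a *: f + k).
Proof.
move=> sf sk i l.
by apply: (Ck_on_lin (a := a) (@chart_image_open _ _ _ X i) (sf i l) (sk i l)).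
Qed.

Lemma smooth_zero : smooth X (0 : M -> R).
Proof.
move=> i l; rewrite /= (_ : (fun _ => _) = cst 0)//.
elim: l => [|l IH] /=; first by move=> x _; exact: cst_continuous.
split=> [x _|a]; first exact: differentiable_cst.
by rewrite (_ : (fun x => _) = cst 0)//; apply/funext => x; rewrite derive_cst.
Qed.

Lemma chart_image i p : chart_dom i p -> (chart i @` chart_dom (s := X) i) (chart i p).
Proof. by exists p. Qed.

Lemma smooth_continuous (f : M -> R) : smooth X f -> continuous f.
Proof.
move=> sf p; set i := chart_at X p; have ip : chart_dom i p := chart_atP X p.
have fc : {for chart i p, continuous (f \o chart_inv i)}.
  exact: (sf i 0%N _ (chart_image ip)).
have h : f (chart_inv i (chart i q)) @[q --> p] --> f (chart_inv i (chart i p)).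
  exact: (continuous_comp (chart_continuous ip) fc).
rewrite chartK// in h; apply: (cvg_near_eq h).
by apply: (near_open (@chart_dom_open _ _ _ X i) ip) => q iq; rewrite chartK.
Qed.

Lemma smooth_differentiable (f : M -> R) (i : chart_index X) (x : 'rV[R]_n) :
  smooth X f ->
  (chart i @` chart_dom i) x -> differentiable (fun y => f (chart_inv i y)) x.
Proof. by move=> /(_ i 1%N)[+ _] ix; apply. Qed.

Lemma smooth_continuous_derive (f : M -> R) (i : chart_index X)
    (x : 'rV[R]_n) a : smooth X f ->
  (chart i @` chart_dom i) x ->
  {for x, continuous (fun y => 'D_(delta_mx 0 a) (fun z => f (chart_inv i z)) y)}.
Proof. by move=> /(_ i 1%N)[_ /(_ a)] + ix; apply. Qed.

Lemma differential_at_lin (a : R) (f k : M -> R) (i : chart_index X) x :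
  smooth X f -> smooth X k ->
  (chart i @` chart_dom i) x ->
  differential_at i (a *: f + k) x =
  a *: differential_at i f x + differential_at i k x.
Proof.
move=> sf sk ix; apply/rowP => b; rewrite !mxE.
have df := smooth_differentiable sf ix; have dk := smooth_differentiable sk ix.
have -> : (fun y => (a *: f + k) (chart_inv i y)) =
  a *: (fun y => f (chart_inv i y)) + (fun y => k (chart_inv i y)) by [].
have df' := diff_derivable df; have dk' := diff_derivable dk.
by rewrite deriveD ?deriveZ//; exact: derivableZ.
Qed.

Lemma transition_differentiable i j p : chart_dom i p -> chart_dom j p ->
  differentiable (transition (X := X) i j) (chart i p).
Proof.
move=> ip jp.
have -> : transition i j = \sum_(a < n)
    (fun x => chart j (chart_inv i x) 0 a *: (delta_mx 0 a : 'rV[R]_n)).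
  apply/funext => x; rewrite fct_sumE /transition.
  exact: row_sum_delta.
apply: differentiable_sum => a; apply: differentiableZl.
by have [+ _] := transition_smooth i j a 1%N; apply; exists p.
Qed.

(** The chain rule for the change of charts. *)
Lemma differential_at_transition (f : M -> R) i j p : smooth X f ->
  chart_dom i p -> chart_dom j p ->
  differential_at i f (chart i p) =
  differential_at j f (chart j p) *m ('J (transition (X := X) i j) (chart i p))^T.
Proof.
move=> sf ip jp; set x := chart i p; set t := transition i j.
have tx : t x = chart j p by rewrite /t /transition chartK.
have dt : differentiable t x by exact: transition_differentiable.
have df : differentiable (fun y => f (chart_inv j y)) (t x).
  by rewrite tx; apply: smooth_differentiable => //; exact: chart_image.
have near_f : \forall y \near x,
    f (chart_inv i y) = ((fun y => f (chart_inv j y)) \o t) y.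
  have ix := chart_image ip.
  have ic : chart_inv i y @[y --> x] --> chart_inv i x := chart_inv_continuous ix.
  rewrite (chartK ip : chart_inv i x = p) in ic.
  have h : \forall y \near x, chart_dom j (chart_inv i y).
    exact: ic (open_nbhs_nbhs (conj (@chart_dom_open _ _ _ X j) jp)).
  near=> y; rewrite /= /t /transition chartK//; near: y; exact: h.
apply/rowP => a; rewrite [LHS]mxE (near_eq_derive _ near_f) deriveE; last first.
  exact: differentiable_comp.
rewrite diff_comp//= -(deriveE _ dt) deriveEjacobian// -rowE.
set v := row a _.
have -> : v = \sum_b v 0 b *: delta_mx 0 b by exact: row_sum_delta.
rewrite linear_sum /= mxE; apply: eq_bigr => b _.
rewrite linearZ -deriveE// tx mulrC [X in X * _]mxE [X in _ * X]mxE /v.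
by rewrite [row _ _ _ _]mxE.
Unshelve. all: by end_near. Qed.

End SmoothFunctions.

Section GradInner.
Context (R : realType) (n : nat) (M : ptopologicalType).
Context (X : smooth_atlas R n M) (g : riemannian_metric X).

Definition chart_grad_inner (i : chart_index X) (f k : M -> R) (p : M) : R :=
  (differential_at i f (chart i p) *m invmx (metric_mx g i (chart i p))
     *m (differential_at i k (chart i p))^T) 0 0.

Lemma metric_unitmx i p : chart_dom i p -> metric_mx g i (chart i p) \in unitmx.
Proof.
by move=> ip; apply: posdef_unitmx; apply: metric_pos; exact: chart_image.
Qed.

(** In the change of charts the Jacobian matrices of the differentials cancel those
    of the inverse metric. *)
Lemma grad_inner_chart i f k p : smooth X f -> smooth X k -> chart_dom i p ->
  grad_inner g f k p = chart_grad_inner i f k p.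
Proof.
move=> sf sk ip; rewrite /grad_inner /chart_grad_inner; set j := chart_at X p.
have jp : chart_dom j p := chart_atP X p.
have uj := metric_unitmx jp; have ui := metric_unitmx ip.
rewrite (differential_at_transition sf jp ip) (differential_at_transition sk jp ip).
have mt : metric_mx g j (chart j p) = _ :=
  metric_transition g (ex_intro2 _ _ p (conj jp ip) erefl).
rewrite /transition chartK// -/(transition j i) in mt.
move: uj; rewrite mt; set J := 'J _ _; set G := metric_mx g i _ in ui *.
move=> uJ.
have uJJ : J \in unitmx by move: uJ; rewrite !unitmx_mul -andbA => /andP[].
have uJT : J^T \in unitmx by rewrite unitmx_tr.
congr (_ _ _); rewrite trmx_mul trmxK !mulmxA; congr (_ *m _).
rewrite -!mulmxA; congr (_ *m _).
apply: (can_inj (mulKmx ui)); rewrite mulmxV//.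
apply: (can_inj (mulKmx uJJ)); rewrite mulmx1 !mulmxA.
by rewrite mulmxV// mul1mx.
Qed.

Lemma grad_inner_sym f k p : smooth X f -> smooth X k ->
  grad_inner g f k p = grad_inner g k f p.
Proof.
by move=> sf sk; apply: posdef_inv_sym; apply: (Defs.metric_sym g); apply: chart_image;
  exact: chart_atP.
Qed.

Lemma grad_inner_ge0 f p : 0 <= grad_inner g f f p.
Proof.
apply: posdef_inv_ge0.
  by apply: (Defs.metric_sym g); apply: chart_image; exact: chart_atP.
by apply: (metric_pos g); apply: chart_image; exact: chart_atP.
Qed.

Lemma grad_inner_linl a f u k p : smooth X f -> smooth X u -> smooth X k ->
  grad_inner g (a *: f + u) k p = a * grad_inner g f k p + grad_inner g u k p.
Proof.
move=> sf su sk; rewrite /grad_inner differential_at_lin//; last first.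
  by apply: chart_image; exact: chart_atP.
by rewrite !mulmxDl -!scalemxAl mxE [X in X + _]mxE.
Qed.

(** The chart that defines the left-hand side varies with the point, without any
    continuity; near a given point it can be fixed. *)
Lemma grad_inner_continuous f k : smooth X f -> smooth X k ->
  continuous (grad_inner g f k).
Proof.
move=> sf sk p; set i := chart_at X p; have ip : chart_dom i p := chart_atP X p.
rewrite /continuous_at (grad_inner_chart sf sk ip).
have h : chart_grad_inner i f k q @[q --> p] --> chart_grad_inner i f k p.
  apply: (@cvg_comp _ _ _ (chart i) (fun x => (differential_at i f x
     *m invmx (metric_mx g i x) *m (differential_at i k x)^T) 0 0) _ _ _
     (chart_continuous ip)).
  have ix := chart_image ip.
  apply: cvg_mulmx => [a b|a b].
    apply: cvg_mulmx => [c e|c e].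
      by rewrite mxE; under eq_cvg do rewrite mxE; exact: smooth_continuous_derive.
    apply: cvg_invmx; first exact: metric_unitmx.
    by move=> c' e'; exact: (@metric_smooth _ _ _ _ g i c' e' 0%N _ ix).
  rewrite !mxE; under eq_cvg do rewrite !mxE; exact: smooth_continuous_derive.
have e : \forall q \near p, chart_grad_inner i f k q = grad_inner g f k q.
  apply: (near_open (@chart_dom_open _ _ _ X i) ip) => q iq.
  by rewrite (grad_inner_chart sf sk iq).
exact: (cvg_near_eq h e).
Qed.

End GradInner.

(** * Finiteness of the volume *)

Section VolumeFinite.
Context (R : realType) (n : nat) (M : ptopologicalType).
Context (X : smooth_atlas R n M) (g : riemannian_metric X).
Context (vol : {measure set (borel M) -> \bar R}).
Hypothesis volg : riemannian_volume g vol.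

Lemma open_borel (U : set M) : open U -> measurable (U : set (borel M)).
Proof. by move=> oU; exact: sub_sigma_algebra. Qed.

(** In a chart, near a point, the coordinates and the density are bounded. *)
Lemma volume_locally_finite p :
  exists U : set M, [/\ open U, U p & (vol U < +oo)%E].
Proof.
set i := chart_at X p; have ip : chart_dom i p := chart_atP X p.
set x := chart i p.
pose r : R := \sum_k `|x 0 k| + 1.
pose C : R := Num.sqrt (\det (metric_mx g i x)) + 1.
have r0 : 0 <= r by rewrite addr_ge0// sumr_ge0.
have C0 : 0 <= C by rewrite addr_ge0// sqrtr_ge0.
have xc : chart i q @[q --> p] --> x := chart_continuous ip.
have near_r : \forall q \near p, forall k, `|chart i q 0 k| <= r.
  apply: filter_forall => k.
  have kc : chart i q 0 k @[q --> p] --> x 0 k.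
    exact: (cvg_comp _ _ xc (@coord_continuous _ _ _ 0 k x)).
  have kr : `|x 0 k| < r.
    by rewrite ltr_pwDr// (bigD1 k)//= lerDl sumr_ge0.
  exact: (cvgr_norm_le _ kc _ kr).
have near_C : \forall q \near p, Num.sqrt (\det (metric_mx g i (chart i q))) <= C.
  have dc : Num.sqrt (\det (metric_mx g i y)) @[y --> x] -->
      Num.sqrt (\det (metric_mx g i x)).
    have dd : \det (metric_mx g i y) @[y --> x] --> \det (metric_mx g i x).
      apply: (@cvg_det R n _ (nbhs x)) => a b.
      exact: (@metric_smooth _ _ _ _ g i a b 0%N _ (chart_image ip)).
    exact: (cvg_comp _ _ dd (@sqrt_continuous R _)).
  have qc := cvg_comp _ _ xc dc.
  have CC : Num.sqrt (\det (metric_mx g i x)) < C by rewrite ltrDl.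
  exact: (cvgr_le _ qc _ CC).
have near_i : \forall q \near p, chart_dom i q.
  exact: open_nbhs_nbhs (conj (@chart_dom_open _ _ _ X i) ip).
have FF : Filter (nbhs p) by exact: nbhs_filter.
have /(_ FF FF) := filterI near_i (filterI near_r near_C).
rewrite nbhsE => -[U [oU Up] UP].
exists U; split=> //.
have mU := open_borel oU.
rewrite (@volg i _ mU); last by move=> q /UP[].
apply: le_lt_trans (ltry (C * (2 * r) ^+ n)).
apply: integral_rV_le => //.
  move=> y; rewrite !lee_fin indicE; have [|_] := boolP (y \in _).
    by rewrite inE => -[q /UP[_ [_ qC]] <-]; rewrite mul1r sqrtr_ge0.
  by rewrite mul0r lexx.
move=> y; rewrite indicE; have [|_] := boolP (y \in _); last by rewrite mul0r eqxx.
by rewrite inE => -[q /UP[_ [qr _]] <-] _.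
Qed.

Lemma volume_finite : compact [set: M] -> (vol setT < +oo)%E.
Proof.
move=> cM; have /choice[U UP] := volume_locally_finite.
have := cM; rewrite compact_cover => /(_ M setT U) [||D _ DM].
- by move=> p _; case: (UP p).
- by move=> p _; exists p => //; case: (UP p).
have -> : [set: M] = \big[setU/set0]_(p <- finmap.enum_fset D) (U p : set (borel M)).
  by rewrite -bigcup_fset; apply/seteqP; split=> // q /DM.
suff [] : measurable (\big[setU/set0]_(p <- finmap.enum_fset D) (U p : set (borel M))) /\
    (vol (\big[setU/set0]_(p <- finmap.enum_fset D) (U p : set (borel M))) < +oo)%E by [].
apply: (big_ind (fun A : set (borel M) => measurable A /\ (vol A < +oo)%E)).
- by rewrite measure0.
- move=> A B [mA fA] [mB fB]; split; first exact: measurableU.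
  by apply: le_lt_trans (measureU2 _ mA mB) _; rewrite lte_add_pinfty.
- by move=> p _; case: (UP p) => oU _ fU; split=> //; exact: open_borel.
Qed.

End VolumeFinite.

Lemma compact_continuous_bounded (R : realType) (M : topologicalType) (f : M -> R) :
  compact [set: M] -> continuous f -> exists C, forall x, `|f x| <= C.
Proof.
move=> cM fc; have : compact (f @` [set: M]).
  by apply: continuous_compact => //; exact: continuous_subspaceT.
move=> /compact_bounded[C [_ CP]]; exists (C + 1) => x.
by apply: (CP (C + 1)); [rewrite ltrDl|exists x].
Qed.

(** * The Dirichlet form of a conformal metric *)

Section DirichletForm.
Context (R : realType) (n : nat) (M : ptopologicalType).
Context (X : smooth_atlas R n M) (g : riemannian_metric X).
Context (vol : {measure set (borel M) -> \bar R}).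
Hypothesis cM : compact [set: M].
Hypothesis vol_fin : (vol setT < +oo)%E.

Definition energy_weight (h : M -> R) : M -> R :=
  fun x => expR ((n%:R - 2) * h x).

Lemma expR_weight (a : R) (h : M -> R) : continuous h ->
  bounded_weight (fun x => expR (a * h x)).
Proof.
move=> hc; have ac : continuous (fun x => a * h x).
  by move=> x; apply: cvgM; [exact: cvg_cst|exact: hc].
have ec : continuous (fun x => expR (a * h x)).
  by move=> x; exact: (cvg_comp _ _ (ac x) (@continuous_expR R _)).
split; first exact: continuous_borel.
have [C CP] := compact_continuous_bounded cM ac.
exists (expR (- C)), (expR C); split; first exact: expR_gt0.
by move=> x; rewrite !ler_expR -ler_norml.
Qed.

Lemma conf_weight_bounded (h : M -> R) : continuous h ->
  bounded_weight (conf_weight n h).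
Proof. exact: expR_weight. Qed.

Lemma energy_weight_bounded (h : M -> R) : continuous h ->
  bounded_weight (energy_weight h).
Proof. exact: expR_weight. Qed.

Lemma bounded_weight_le (w w' : M -> R) : bounded_weight w -> bounded_weight w' ->
  exists2 C, 0 < C & forall x, w' x <= C * w x.
Proof.
move=> [_ [c [C [c0 cC]]]] [_ [c' [C' [c'0 cC']]]].
have C'0 : 0 < C'.
  by have /andP[h1 h2] := cC' point; rewrite (lt_le_trans c'0)// (le_trans h1).
exists (C' / c) => [|x]; first exact: divr_gt0.
have /andP[h1 _] := cC x; have /andP[_ h2] := cC' x.
by rewrite mulrAC ler_pdivlMr// ler_pM// ltW// (lt_le_trans c'0)//; case/andP: (cC' x).
Qed.

Lemma energy_integrable (h f k : M -> R) : continuous h ->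
  smooth X f -> smooth X k ->
  vol.-integrable [set: borel M]
    (EFin \o (fun x => grad_inner g f k x * energy_weight h x)).
Proof.
move=> hc sf sk; have gc := grad_inner_continuous (g := g) sf sk.
have [mw [c [C [c0 cC]]]] := energy_weight_bounded hc.
have [B BP] := compact_continuous_bounded cM gc.
apply: measurable_bounded_integrable => //.
  by apply: measurable_funM => //; exact: continuous_borel.
exists (B * C); split; first exact: num_real.
move=> K BK x _ /=; apply: le_trans (ltW BK); rewrite normrM ler_pM//.
have /andP[h1 h2] := cC x; rewrite ger0_norm//.
exact: le_trans (ltW c0) h1.
Qed.

(** The integrals are finite because the energy density of smooth functions is
    continuous on a compact space of finite volume. *)
Lemma pre_dirichlet_semi (h : M -> R) : continuous h ->
  semi_inner [set f | smooth X f] (pre_dirichlet g vol h).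
Proof.
move=> hc; split.
- exact: smooth_zero.
- by move=> a u v /= su sv; exact: smooth_lin.
- move=> u v su sv; rewrite /pre_dirichlet; apply: (congr1 ( *%R _)).
  by apply: eq_Rintegral => x _; rewrite (grad_inner_sym g x su sv).
- move=> a u v k /= su sv sk; rewrite /pre_dirichlet.
  have i1 := energy_integrable hc su sk; have i2 := energy_integrable hc sv sk.
  rewrite mulrCA -mulrDr; apply: (congr1 ( *%R _)).
  rewrite -RintegralZl// -RintegralD//; last exact: (integrableZl _ a i1).
  by apply: eq_Rintegral => x _ /=; rewrite (grad_inner_linl g a x su sv sk) mulrDl mulrA.
- move=> u su; rewrite /pre_dirichlet mulr_ge0// Rintegral_ge0// => x _.
  by rewrite mulr_ge0 ?grad_inner_ge0// ltW// expR_gt0.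
Qed.

Lemma pre_dirichlet_le (h h' : M -> R) (C : R) (f : M -> R) :
  continuous h -> continuous h' ->
  (forall x, energy_weight h' x <= C * energy_weight h x) -> smooth X f ->
  pre_dirichlet g vol h' f f <= C * pre_dirichlet g vol h f f.
Proof.
move=> hc hc' hC sf; have i := energy_integrable hc sf sf.
have i' := energy_integrable hc' sf sf.
rewrite /pre_dirichlet mulrCA ler_pM2l// -RintegralZl//; apply: le_Rintegral => //.
  exact: (integrableZl _ C i).
move=> x _; rewrite [leRHS]mulrCA; apply: ler_wpM2l; last exact: hC.
exact: grad_inner_ge0.
Qed.

Lemma smooth_L2 (h f : M -> R) : continuous h -> smooth X f ->
  L2 vol (conf_weight n h) f.
Proof.
move=> hc sf; have fc := smooth_continuous sf.
have [mw [c [C [c0 cC]]]] := conf_weight_bounded hc.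
have [B BP] := compact_continuous_bounded cM fc.
have mf := continuous_borel fc; split=> //.
apply: measurable_bounded_integrable => //.
  by apply: measurable_funM => //; exact: (measurable_funX 2).
exists (B ^+ 2 * C); split; first exact: num_real.
move=> K BK x _ /=; apply: le_trans (ltW BK); rewrite normrM ler_pM//.
  by rewrite normrX ler_pXn2r// nnegrE// (le_trans _ (BP point)).
have /andP[h1 h2] := cC x; rewrite ger0_norm//.
exact: le_trans (ltW c0) h1.
Qed.

End DirichletForm.

Section FormDomain.
Context (R : realType) (n : nat) (M : ptopologicalType).
Context (X : smooth_atlas R n M) (g : riemannian_metric X).
Context (vol : {measure set (borel M) -> \bar R}).
Hypothesis cM : compact [set: M].
Hypothesis vol_fin : (vol setT < +oo)%E.

Local Notation approx_space := ((M -> R) * (nat -> M -> R))%type.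

Definition form_domain (h : M -> R) : set approx_space :=
  [set p | form_approx g vol h p.2 p.1].

(** Twice the Dirichlet form, so that its operator is the opposite of the
    Laplacian. *)
Definition dirichlet (h : M -> R) (p r : approx_space) : R :=
  2 * limn (fun k => pre_dirichlet g vol h (p.2 k) (r.2 k)).

Section FixedField.
Context (h : M -> R).
Hypothesis hc : continuous h.
Local Notation w := (conf_weight n h).
Local Notation D := (form_domain h).
Local Notation q := (dirichlet h).
Local Notation pre := (pre_dirichlet g vol h).
Local Notation ip := (L2_inner vol w).

Let ww : bounded_weight w := conf_weight_bounded n cM hc.
Let Lw := L2_inner_semi vol ww.
Let Ps := pre_dirichlet_semi g cM vol_fin hc.
Let sL f : smooth X f -> L2 vol w f.
Proof. by move=> sf; exact: (smooth_L2 cM vol_fin hc sf). Qed.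

Lemma form_domainP (p : approx_space) : D p <->
  [/\ forall k, smooth X (p.2 k), L2 vol w p.1,
      forall e : R, 0 < e -> exists N, forall k, (N <= k)%N ->
        ip (p.2 k - p.1) (p.2 k - p.1) < e &
      si_cauchy pre p.2].
Proof.
have cvgP : (forall k, smooth X (p.2 k)) -> L2 vol w p.1 ->
    (ip (p.2 k \- p.1) (p.2 k \- p.1) @[k --> \oo] --> (0 : R)) <->
    (forall e : R, 0 < e -> exists N, forall k, (N <= k)%N ->
        ip (p.2 k - p.1) (p.2 k - p.1) < e).
  move=> sp Lp; apply: cvgr0P => k; apply: (si_ge0 Lw).
  by apply: (siB_closed Lw) => //; exact: sL.
split=> -[sp Lp pc pC]; split=> //; first exact: (cvgP sp Lp).1.
exact: (cvgP sp Lp).2.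
Qed.

Lemma dirichlet_cvg (p r : approx_space) : D p -> D r ->
  2 * pre (p.2 k) (r.2 k) @[k --> \oo] --> q p r.
Proof.
move=> /form_domainP[sp _ _ pC] /form_domainP[sr _ _ rC].
apply: cvgM; first exact: cvg_cst.
exact: (si_cauchy_cvg Ps).
Qed.

Lemma dirichlet_unique (p r : approx_space) (l : R) : D p -> D r ->
  (2 * pre (p.2 k) (r.2 k) @[k --> \oo] --> l) -> q p r = l.
Proof.
move=> Dp Dr pl; have qc := dirichlet_cvg Dp Dr.
by rewrite -(cvg_lim _ qc)// (cvg_lim _ pl).
Qed.

Lemma form_domain_lin a (p r : approx_space) : D p -> D r -> D (a *: p + r).
Proof.
move=> /form_domainP[sp Lp pc pC] /form_domainP[sr Lr rc rC].
have scaled (u : R) : 0 <= u -> forall e : R, 0 < e -> u * (e / (4 * (u + 1))) < e / 4.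
  move=> u0 e e0; rewrite mulrA ltr_pdivrMr; last by lra.
  by have := mulr_ge0 u0 (ltW e0); lra.
have pos (e : R) : 0 < e -> 0 < e / (4 * (a ^+ 2 + 1)).
  by move=> e0; rewrite divr_gt0//; have := sqr_ge0 a; lra.
have tri (V : lmodType R) (A : set V) (b : V -> V -> R) (u v : V) (e : R) :
    semi_inner A b -> A u -> A v -> 0 < e ->
    b u u < e / (4 * (a ^+ 2 + 1)) -> b v v < e / 4 ->
    b (a *: u + v) (a *: u + v) < e.
  move=> Ab Au Av e0 ue ve.
  have := si_sqD_le Ab (siZ_closed Ab a Au) Av; rewrite (si_sqZ Ab)// => h1.
  have := scaled _ (sqr_ge0 a) e e0.
  have := ler_wpM2l (sqr_ge0 a) (ltW ue).
  by move=> *; lra.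
apply/form_domainP; split.
- by move=> k; exact: smooth_lin.
- exact: L2_lin.
- move=> e e0; have [N1 P1] := pc _ (pos e e0).
  have [N2 P2] := rc _ (ltac:(lra) : 0 < e / 4).
  exists (maxn N1 N2) => k; rewrite geq_max => /andP[/P1 k1 /P2 k2].
  have -> : (a *: p + r).2 k - (a *: p + r).1 =
      a *: (p.2 k - p.1) + (r.2 k - r.1).
    by rewrite scalerBr addrACA -opprD.
  by apply: (tri _ _ _ _ _ _ Lw) => //; apply: (siB_closed Lw) => //; exact: sL.
- move=> e e0; have [N1 P1] := pC _ (pos e e0).
  have [N2 P2] := rC _ (ltac:(lra) : 0 < e / 4).
  exists (maxn N1 N2) => k l; rewrite !geq_max => /andP[k1 k2] /andP[l1 l2].
  have -> : (a *: p + r).2 k - (a *: p + r).2 l =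
      a *: (p.2 k - p.2 l) + (r.2 k - r.2 l).
    by rewrite scalerBr addrACA -opprD.
  have {}P1 := P1 k l k1 l1; have {}P2 := P2 k l k2 l2.
  apply: (tri _ _ _ _ _ _ Ps _ _ e0 P1 P2).
    by apply: (siB_closed Ps); exact: sp.
  by apply: (siB_closed Ps); exact: sr.
Qed.

Lemma dirichlet_semi : semi_inner D q.
Proof.
split.
- apply/form_domainP; split=> [k|||].
  + exact: smooth_zero.
  + exact: (si_zero Lw).
  + move=> e e0; exists 0%N => k _; rewrite subrr.
    by rewrite (si0l Lw)//; exact: (si_zero Lw).
  + move=> e e0; exists 0%N => k l _ _; rewrite subrr.
    by rewrite (si0l Ps)//; exact: (si_zero Ps).
- by move=> a u v; exact: form_domain_lin.
- move=> p r Dp Dr; apply: (dirichlet_unique Dp Dr).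
  have [sp _ _ _] := (form_domainP p).1 Dp; have [sr _ _ _] := (form_domainP r).1 Dr.
  under eq_cvg => k do rewrite (si_sym Ps (sp k) (sr k)).
  exact: dirichlet_cvg.
- move=> a p r s Dp Dr Ds.
  apply: (dirichlet_unique (form_domain_lin a Dp Dr) Ds).
  have [sp _ _ _] := (form_domainP p).1 Dp; have [sr _ _ _] := (form_domainP r).1 Dr.
  have [ss _ _ _] := (form_domainP s).1 Ds.
  under eq_cvg => k.
    rewrite (_ : (a *: p + r).2 k = a *: p.2 k + r.2 k)//.
    rewrite (si_linl Ps a (sp k) (sr k) (ss k)) mulrDr mulrCA.
    over.
  exact: (cvgD (cvgM (cvg_cst a) (dirichlet_cvg Dp Ds)) (dirichlet_cvg Dr Ds)).
- move=> p Dp; have [sp _ _ _] := (form_domainP p).1 Dp.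
  have pc := dirichlet_cvg Dp Dp; rewrite -(cvg_lim _ pc)//.
  apply: limr_ge; first by apply/cvg_ex; exists (q p p).
  by apply: nearW => k; rewrite mulr_ge0// (si_ge0 Ps (sp k)).
Qed.

Definition smooth_embed (f : M -> R) : approx_space := (f, fun=> f).

Lemma smooth_embed_domain f : smooth X f -> D (smooth_embed f).
Proof.
move=> sf; apply/form_domainP; split.
- by move=> k; exact: sf.
- exact: sL.
- move=> e e0; exists 0%N => k _; rewrite subrr.
  by rewrite (si0l Lw)//; exact: (si_zero Lw).
- move=> e e0; exists 0%N => k l _ _; rewrite subrr.
  by rewrite (si0l Ps)//; exact: (si_zero Ps).
Qed.

Lemma dirichlet_le (p : approx_space) (e : R) N : D p ->
  (forall k, (N <= k)%N -> pre (p.2 k) (p.2 k) <= e) -> q p p <= 2 * e.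
Proof.
move=> Dp pe; have pc := dirichlet_cvg Dp Dp.
rewrite -(cvg_lim _ pc)//; apply: limr_le; first by apply/cvg_ex; exists (q p p).
by exists N => // k /= /pe; rewrite ler_pM2l.
Qed.

(** A late member of the approximating sequence of [p] works. *)
Lemma smooth_dense (p : approx_space) (e : R) : D p -> 0 < e ->
  exists2 f, smooth X f & q (p - smooth_embed f) (p - smooth_embed f) < e /\
    ip (p.1 - f) (p.1 - f) < e.
Proof.
move=> Dp e0; have [sp Lp pc pC] := (form_domainP p).1 Dp.
have [N1 P1] := pc e e0; have [N2 P2] := pC (e / 4) ltac:(lra).
pose N := maxn N1 N2; exists (p.2 N) => //; split; last first.
  rewrite (si_distC Lw Lp (sL (sp N))); apply: P1; exact: leq_maxl.
apply: (@le_lt_trans _ _ (2 * (e / 4))); last by lra.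
apply: (@dirichlet_le _ _ N).
  exact: (siB_closed dirichlet_semi Dp (smooth_embed_domain (sp N))).
move=> k Nk; apply: ltW; apply: P2; last exact: leq_maxr.
by rewrite (leq_trans _ Nk)// leq_maxr.
Qed.

Definition form_norm (p r : approx_space) : R := q p r + ip p.1 r.1.

Lemma form_norm_semi : semi_inner D form_norm.
Proof.
have Dq := dirichlet_semi.
have LD r : D r -> L2 vol w r.1 by move=> /form_domainP[].
split.
- exact: (si_zero Dq).
- exact: (si_lin Dq).
- move=> u v Du Dv; rewrite /form_norm (si_sym Dq Du Dv).
  by rewrite (si_sym Lw (LD _ Du) (LD _ Dv)).
- move=> a u v k Du Dv Dk; rewrite /form_norm (si_linl Dq a Du Dv Dk).
  have -> : ip (a *: u + v).1 k.1 = a * ip u.1 k.1 + ip v.1 k.1.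
    exact: (si_linl Lw a (LD _ Du) (LD _ Dv) (LD _ Dk)).
  move: (q u k) (q v k) (ip _ _) (ip _ _) => s1 s2 s3 s4; ring.
- move=> u Du; apply: addr_ge0; first exact: (si_ge0 Dq).
  exact: (si_ge0 Lw (LD _ Du)).
Qed.

(** The form is defined on the completion of the smooth functions: a Cauchy
    sequence is shadowed by smooth functions, which approximate its limit. *)
Lemma form_norm_complete : si_complete D form_norm.
Proof.
move=> p Dp pC; have Dq := dirichlet_semi; have DQ := form_norm_semi.
have [r r0 small] := null_sequence R.
have /choice[chi chiP] j : exists f, smooth X f /\
    q (p j - smooth_embed f) (p j - smooth_embed f) < r j /\
    ip ((p j).1 - f) ((p j).1 - f) < r j.
  by have [f sf fP] := smooth_dense (Dp j) (r0 j); exists f.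
have schi j : smooth X (chi j) by case: (chiP j).
pose c j := smooth_embed (chi j).
have Dc j : D (c j) := smooth_embed_domain (schi j).
have pcj j : form_norm (p j - c j) (p j - c j) < 2 * r j.
  by have [_ [h1 h2]] := chiP j; rewrite /form_norm mulr_natl mulr2n ltrD.
have pc_close : si_close form_norm p c.
  move=> e e0; have [N NP] := small (e / 2) ltac:(lra).
  exists N => k /NP rk; apply: (lt_trans (pcj k)).
  by rewrite mulrC -ltr_pdivlMr.
have cC : si_cauchy form_norm c := si_close_cauchy DQ Dp Dc pc_close pC.
have q_c k l : q (c k - c l) (c k - c l) = 2 * pre (chi k - chi l) (chi k - chi l).
  have Dkl := siB_closed Dq (Dc k) (Dc l).
  apply: (dirichlet_unique Dkl Dkl).
  exact: (cvg_cst (2 * pre (chi k - chi l) (chi k - chi l))).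
have schiB k l : smooth X (chi k - chi l) := siB_closed Ps (schi k) (schi l).
have chiC (e : R) : 0 < e -> exists N, forall k l, (N <= k)%N -> (N <= l)%N ->
    ip (chi k - chi l) (chi k - chi l) < e /\ pre (chi k - chi l) (chi k - chi l) < e.
  move=> e0; have [N NP] := cC e e0; exists N => k l Nk Nl.
  have := NP k l Nk Nl; rewrite /form_norm q_c.
  have := si_ge0 Lw (sL (schiB k l)); have := si_ge0 Ps (schiB k l).
  by rewrite -/((c k - c l).1) /=; move=> h1 h2 h3; split; lra.
have [e e0|u Lu uP] := L2_complete vol_fin ww (fun k => sL (schi k)).
  by have [N NP] := chiC e e0; exists N => k l Nk Nl; case: (NP k l Nk Nl).
pose P : approx_space := (u, chi).
have DP : D P.
  apply/form_domainP; split; [exact: schi|exact: Lu|exact: uP|move=> e e0].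
  by have [N NP] := chiC e e0; exists N => k l Nk Nl; case: (NP k l Nk Nl).
exists P => //; apply: (si_close_limit DQ Dp Dc DP pc_close) => e e0.
have [N1 P1] := uP (e / 2) ltac:(lra); have [N2 P2] := chiC (e / 8) ltac:(lra).
exists (maxn N1 N2) => k; rewrite geq_max => /andP[k1 k2].
have h1 : q (c k - P) (c k - P) <= 2 * (e / 8).
  apply: (@dirichlet_le _ _ N2); first exact: (siB_closed Dq (Dc k) DP).
  by move=> l Nl; apply: ltW; case: (P2 k l k2 Nl).
have h2 : ip (c k - P).1 (c k - P).1 < e / 2 := P1 k k1.
by apply: (le_lt_trans (lerD h1 (ltW h2))); lra.
Qed.

End FixedField.
End FormDomain.

(** * The spectral gap in terms of the Dirichlet form *)

Section FieldIndependence.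
Context (R : realType) (n : nat) (M : ptopologicalType).
Context (X : smooth_atlas R n M) (g : riemannian_metric X).
Context (vol : {measure set (borel M) -> \bar R}).
Hypothesis cM : compact [set: M].
Hypothesis vol_fin : (vol setT < +oo)%E.
Local Notation approx_space := ((M -> R) * (nat -> M -> R))%type.

Lemma form_domain_sub (h h' : M -> R) : continuous h -> continuous h' ->
  form_domain g vol h `<=` form_domain g vol h'.
Proof.
move=> hc hc' p /(form_domainP g cM vol_fin hc)[sp Lp pc pC].
have ww := conf_weight_bounded n cM hc; have ww' := conf_weight_bounded n cM hc'.
have [a a0 aP] := bounded_weight_le ww ww'.
have [c c0 cP] := bounded_weight_le (energy_weight_bounded n cM hc)
  (energy_weight_bounded n cM hc').
have Ps := pre_dirichlet_semi g cM vol_fin hc.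
apply/(form_domainP g cM vol_fin hc'); split.
- exact: sp.
- exact: (L2_weight ww ww' Lp).
- move=> e e0; have [N NP] := pc _ (divr_gt0 e0 a0); exists N => k Nk.
  have Lk : L2 vol (conf_weight n h) (p.2 k - p.1).
    apply: (siB_closed (L2_inner_semi vol ww)); last exact: Lp.
    exact: (smooth_L2 cM vol_fin hc (sp k)).
  apply: (le_lt_trans (L2_inner_le ww ww' aP Lk)).
  by rewrite mulrC -ltr_pdivlMr//; exact: NP.
- move=> e e0; have [N NP] := pC _ (divr_gt0 e0 c0); exists N => k l Nk Nl.
  have skl := siB_closed Ps (sp k) (sp l).
  apply: (le_lt_trans (pre_dirichlet_le g cM vol_fin hc hc' cP skl)).
  by rewrite mulrC -ltr_pdivlMr//; exact: NP.
Qed.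

Lemma form_domain_eq (h h' : M -> R) : continuous h -> continuous h' ->
  form_domain g vol h = form_domain g vol h'.
Proof. by move=> hc hc'; apply/seteqP; split; exact: form_domain_sub. Qed.

Lemma dirichlet_weight_le (h h' : M -> R) (a : R) (p : approx_space) :
  continuous h -> continuous h' ->
  (forall x, energy_weight n h' x <= a * energy_weight n h x) ->
  form_domain g vol h p ->
  dirichlet g vol h' p p <= a * dirichlet g vol h p p.
Proof.
move=> hc hc' aP Dp; have Dp' := form_domain_sub hc hc' Dp.
have pc := dirichlet_cvg cM vol_fin hc Dp Dp.
have pc' := dirichlet_cvg cM vol_fin hc' Dp' Dp'.
have [sp _ _ _] := (form_domainP g cM vol_fin hc p).1 Dp.
apply: (ler_cvg_to pc' (cvgM (cvg_cst a) pc)); apply: nearW => k.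
change (2 * pre_dirichlet g vol h' (p.2 k) (p.2 k) <=
  a * (2 * pre_dirichlet g vol h (p.2 k) (p.2 k))).
rewrite [leRHS]mulrCA ler_pM2l//.
exact: (pre_dirichlet_le g cM vol_fin hc hc' aP (sp k)).
Qed.

End FieldIndependence.

Section SpectralGap.
Context (R : realType) (n : nat) (M : ptopologicalType).
Context (X : smooth_atlas R n M) (g : riemannian_metric X).
Context (vol : {measure set (borel M) -> \bar R}).
Hypothesis cM : compact [set: M].
Hypothesis vol_fin : (vol setT < +oo)%E.
Context (lam : nat -> R) (e_ : nat -> M -> R).
Hypothesis basis : laplacian_eigenbasis g vol lam e_.
Local Notation approx_space := ((M -> R) * (nat -> M -> R))%type.
Local Notation zero_fun := (fun _ : M => 0 : R).

Let zc : continuous zero_fun := @cst_continuous _ _ (0 : R).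

Section FixedField.
Context (h : M -> R).
Hypothesis hc : continuous h.
Local Notation w := (conf_weight n h).
Local Notation H := [set f | L2 vol w f].
Local Notation D := (form_domain g vol h).
Local Notation q := (dirichlet g vol h).
Local Notation ip := (L2_inner vol w).
Local Notation T := (opp_laplacian g vol h).

Let ww : bounded_weight w := conf_weight_bounded n cM hc.
Let Lw := L2_inner_semi vol ww.

Let LD (p : approx_space) : D p -> L2 vol w p.1.
Proof. by move=> /(form_domainP g cM vol_fin hc)[]. Qed.

(** The eigenfunctions for the field 0 belong to the form domain of [h], and
    orthogonality to them for the weight e^{nh} is orthogonality of [f e^{nh}] for
    the weight 1. *)
Lemma form_domain_dense f : L2 vol w f -> (forall p, D p -> ip f p.1 = 0) ->
  ip f f = 0.
Proof.
move=> Lf orth; have [ek _ complete] := basis.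
have one_zero : (fun=> 1) = conf_weight n zero_fun :> (M -> R).
  by apply/funext => x; rewrite /conf_weight mulr0 expR0.
have h2c : continuous (fun x => h x + h x : R).
  by move=> x; apply: cvgD; exact: hc.
(* (f w)^2 = f^2 w^2, and w^2 is again a conformal weight *)
have Lfw : L2 vol (fun=> 1) (fun x => f x * w x).
  have [mf _] := Lf; have [mw _] := ww.
  have [_ f2] := L2_weight ww (conf_weight_bounded n cM h2c) Lf.
  split; first exact: measurable_funM.
  apply: eq_integrable f2 => // x _; congr (_%:E).
  by rewrite /conf_weight mulrDr expRD mulr1 exprMn -expr2.
have fw0 : (fun x => f x * w x) = zero_fun %[ae vol].
  apply: complete Lfw _ => k.
  have [_ [phi ephi _]] := ek k.
  have Dk : form_domain g vol zero_fun (e_ k, phi) := ephi.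
  have := orth _ (form_domain_sub cM vol_fin zc hc Dk).
  rewrite /L2_inner /= => <-; apply: eq_Rintegral => x _.
  by rewrite mulr1 mulrAC.
apply/(L2_inner_null ww Lf); apply: (@filterS (borel M) _ _ _ _ _ fw0) => x fx _.
have := fx Logic.I => /eqP; rewrite mulf_eq0 => /orP[/eqP//|].
by rewrite (gt_eqF (weight_gt0 ww x)).
Qed.

Lemma dirichlet_closed_form : closed_form H D fst ip q.
Proof.
split.
- by [].
- exact: LD.
- exact: Lw.
- exact: (dirichlet_semi g cM vol_fin hc).
- exact: (L2_complete vol_fin ww).
- exact: (form_norm_complete cM vol_fin hc).
- exact: form_domain_dense.
Qed.

(** The graph of the operator in the sense of the definition by sequences is that of
    the operator of the form: the form is the limit along the given sequences. *)
Lemma opp_laplacianP u f :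
  T u f <-> exists2 p : approx_space, p.1 = u & form_graph H D fst ip q p f.
Proof.
have LN k : L2 vol w (fun x => - k x) <-> L2 vol w k.
  have N (k' : M -> R) : L2 vol w k' -> L2 vol w (fun x => - k' x).
    by move=> Lk; have := siZ_closed Lw (-1) Lk; rewrite scaleN1r.
  split=> [/N|/N//]; rewrite (_ : (fun x => - - k x) = k)//.
  by apply/funext => x; rewrite opprK.
have ipN k v : L2 vol w k -> L2 vol w v -> ip (fun x => - k x) v = - ip k v.
  move=> Lk Lv; have -> : (fun x => - k x) = (-1) *: k by rewrite scaleN1r.
  by rewrite (siZl Lw)// mulN1r.
split=> [[/LN Lf [phi uphi phiP]]|[[u' phi] /= <- [Dp Lf pP]]].
  exists (u, phi) => //; split=> // -[v psi] Dv.
  apply: (dirichlet_unique cM vol_fin hc (uphi : D (u, phi)) Dv).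
  have -> : ip f v = 2 * (- 2^-1 * ip (fun x => - f x) v).
    by rewrite ipN//; [field|exact: LD Dv].
  by apply: cvgM; [exact: cvg_cst|exact: phiP Dv].
split; first exact/LN.
exists phi; first exact: Dp.
move=> v psi vpsi; have Dv : D (v, psi) := vpsi.
have c : 2^-1 * (2 * pre_dirichlet g vol h (phi k) (psi k)) @[k --> \oo] -->
    2^-1 * q (u', phi) (v, psi).
  exact: (cvgM (cvg_cst (2^-1 : R)) (dirichlet_cvg cM vol_fin hc Dp Dv)).
rewrite (ipN _ _ Lf (LD Dv)) mulrNN -(pP _ Dv).
rewrite (_ : (fun k => 2^-1 * (2 * pre_dirichlet g vol h (phi k) (psi k))) =
  (fun k => pre_dirichlet g vol h (phi k) (psi k))) in c; last first.
  by apply/funext => k; rewrite mulKf.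
exact: c.
Qed.

Lemma resolvent_regular z : resolvent_set vol w T z <-> regular H D fst ip q z.
Proof.
have Hz p f : form_graph H D fst ip q p f -> L2 vol w (f - z *: p.1).
  move=> [Dp Lf _]; apply: (siB_closed Lw) => //.
  by apply: (siZ_closed Lw); exact: LD.
split=> -[inj [C CP]]; split.
- move=> p f pf n0; have [Dp Lf _] := pf.
  apply/(L2_inner_null ww (LD Dp)); apply: (inj _ f).
    by apply/opp_laplacianP; exists p.
  have /(L2_inner_null ww (Hz _ _ pf)) fz := n0.
  by apply: (@filterS (borel M) _ _ _ _ _ fz) => x /(_ Logic.I)/subr0_eq.
- exists C => f Lf; have [u [k [/opp_laplacianP[p <- pk] kf le_C]]] := CP f Lf.
  exists p, k; split; [exact: pk| |exact: le_C].
  apply/(L2_inner_null ww (siB_closed Lw (Hz _ _ pk) Lf)).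
  apply: (@filterS (borel M) _ _ _ _ _ kf) => x /(_ Logic.I) kx _.
  by apply/eqP; rewrite subr_eq0; apply/eqP.
- move=> u f /opp_laplacianP[p <- pf] fz; have [Dp Lf _] := pf.
  apply/(L2_inner_null ww (LD Dp)); apply: (inj _ f pf).
  apply/(L2_inner_null ww (Hz _ _ pf)).
  apply: (@filterS (borel M) _ _ _ _ _ fz) => x /(_ Logic.I) fx _.
  by apply/eqP; rewrite subr_eq0; apply/eqP.
- exists C => f Lf; have [p [k [pk kf le_C]]] := CP f Lf.
  exists p.1, k; split; [by apply/opp_laplacianP; exists p| |exact: le_C].
  have /(L2_inner_null ww (siB_closed Lw (Hz _ _ pk) Lf)) := kf => kf'.
  by apply: (@filterS (borel M) _ _ _ _ _ kf') => x /(_ Logic.I)/subr0_eq.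
Qed.

Lemma energy_gap_spectrum (eps : R) : 0 < eps ->
  energy_gap D fst ip q eps <->
  forall z, spectrum vol w T z -> z != 0 -> eps <= z.
Proof.
move=> e0; rewrite (energy_gapP dirichlet_closed_form e0).
split=> [reg z sz z0|sp z z0 ze].
  rewrite leNgt; apply/negP => ze; apply: sz.
  by apply/resolvent_regular; exact: reg.
apply/resolvent_regular; apply: contrapT => sz.
by have := sp z sz z0; rewrite leNgt ze.
Qed.

End FixedField.
End SpectralGap.

(** * Comparison of the spectral gaps *)

Section InfComparison.
Context (R : realType) (S S' : set R) (c : R).
Hypothesis c0 : 0 < c.
Hypothesis S_ge0 : forall z, S z -> 0 <= z.
Hypothesis S'_ge0 : forall z, S' z -> 0 <= z.
Hypothesis SS' : forall eps : R, 0 < eps ->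
  (forall z, S z -> eps <= z) -> forall z, S' z -> eps * c <= z.
Hypothesis S'S : forall eps : R, 0 < eps ->
  (forall z, S' z -> eps <= z) -> forall z, S z -> eps * c <= z.

Lemma inf_ge0 : 0 <= inf S.
Proof.
have [->|/set0P S0] := eqVneq S set0; first by rewrite inf0.
by apply: lb_le_inf.
Qed.

(** If one of the two sets is empty then so is the other one, because every positive
    number bounds the empty set from below; the infimum of the empty set is 0. *)
Lemma inf_comparison : inf S * c <= inf S'.
Proof.
have [S'0|/set0P S'0] := eqVneq S' set0.
  suff -> : S = set0 by rewrite S'0 inf0 mul0r.
  apply/seteqP; split=> // z Sz; have z0 := S_ge0 Sz.
  have := @S'S ((z + 1) / c) _ _ z Sz; rewrite divfK ?gt_eqF//.
  rewrite S'0 => h; suff : z + 1 <= z by lra.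
  by apply: h => //; rewrite divr_gt0//; lra.
apply: lb_le_inf => // z S'z.
have [l0|l0] := ltP 0 (inf S).
  apply: (SS' l0) => // y Sy; apply: ge_inf => //.
  by exists 0 => t; exact: S_ge0.
apply: le_trans (S'_ge0 S'z); by rewrite pmulr_lle0.
Qed.

End InfComparison.

(** The value 0 is allowed because [ln 0 = 0], and both numbers are 0 together. *)
Lemma ln_ratio (R : realType) (l l' a : R) : 0 <= l -> 0 <= l' -> 0 <= a ->
  l * expR (- a) <= l' -> l' * expR (- a) <= l -> `|ln l' - ln l| <= a.
Proof.
move=> l0 l'0 a0 h h'.
have [lz|lp] := eqVneq l 0.
  have -> : l' = 0.
    apply/eqP; rewrite eq_le l'0 andbT -(pmulr_lle0 _ (expR_gt0 (- a))).
    by rewrite -lz.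
  by rewrite lz subrr normr0.
have {lp}lp : 0 < l by rewrite lt_def lp.
have l'p : 0 < l' by apply: lt_le_trans h; rewrite mulr_gt0 ?expR_gt0.
have lnE (x y : R) : 0 < x -> 0 < y -> x * expR (- a) <= y -> ln x - a <= ln y.
  move=> x0 y0 xy; have := xy; rewrite -ler_ln ?posrE ?mulr_gt0 ?expR_gt0//.
  by rewrite lnM ?posrE ?expR_gt0// expRK.
have := lnE _ _ lp l'p h; have := lnE _ _ l'p lp h'.
by rewrite ler_norml => *; apply/andP; split; lra.
Qed.

Section SpectralGapBound.
Context (R : realType) (n : nat) (M : ptopologicalType).
Context (X : smooth_atlas R n M) (g : riemannian_metric X).
Context (vol : {measure set (borel M) -> \bar R}).
Hypothesis n0 : (0 < n)%N.
Hypothesis cM : compact [set: M].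
Hypothesis vol_fin : (vol setT < +oo)%E.
Context (lam : nat -> R) (e_ : nat -> M -> R).
Hypothesis basis : laplacian_eigenbasis g vol lam e_.
Local Notation gap h := (energy_gap (form_domain g vol h) fst
  (L2_inner vol (conf_weight n h)) (dirichlet g vol h)).
Local Notation spec h :=
  [set z | spectrum vol (conf_weight n h) (opp_laplacian g vol h) z /\ z != 0].

Definition conf_exponent : R := if (2 <= n)%N then 2 * (n%:R - 1) else 2.

(** The energy contributes |n - 2| and the norm contributes n. *)
Lemma conf_exponentE : conf_exponent = `|n%:R - 2| + n%:R.
Proof.
rewrite /conf_exponent; case: ltnP => n2.
  by rewrite ger0_norm ?subr_ge0 ?ler_nat//; ring.
have -> : n = 1%N by apply/eqP; rewrite eqn_leq n2.
by rewrite distrC ger0_norm; lra.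
Qed.

Lemma conf_exponent_gt0 : 0 < conf_exponent.
Proof. by rewrite conf_exponentE ltr_wpDl// ltr0n. Qed.

Lemma weight_ratio (a B : R) (h h' : M -> R) :
  (forall x, `|h' x - h x| <= B) ->
  forall x, expR (a * h' x) <= expR (`|a| * B) * expR (a * h x).
Proof.
move=> hB x; rewrite -expRD ler_expR -lerBlDr -mulrBr.
by apply: le_trans (ler_norm _) _; rewrite normrM ler_wpM2l.
Qed.

Lemma energy_gap_field (h h' : M -> R) (B eps : R) :
  continuous h -> continuous h' -> 0 <= B -> 0 <= eps ->
  (forall x, `|h' x - h x| <= B) ->
  gap h eps -> gap h' (eps * expR (- (conf_exponent * B))).
Proof.
move=> hc hc' B0 eps0 hB; rewrite -(form_domain_eq g cM vol_fin hc hc').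
have hB' x : `|h x - h' x| <= B by rewrite distrC.
have ww := conf_weight_bounded n cM hc; have ww' := conf_weight_bounded n cM hc'.
have Dsub := form_domain_sub cM vol_fin hc hc' : _ `<=` form_domain g vol h'.
have -> : eps * expR (- (conf_exponent * B)) =
    eps / (expR (`|n%:R - 2| * B) * expR (n%:R * B)).
  by rewrite -expRD -mulrDl -conf_exponentE expRN.
have a1 : 1 <= expR (`|n%:R - 2| * B) by rewrite -expR0 ler_expR mulr_ge0.
apply: (energy_gap_le (q := dirichlet g vol h) (b := L2_inner vol (conf_weight n h))
  a1 (expR_gt0 _) eps0).
- by move=> x y Dx Dy; exact: (siB_closed (dirichlet_semi g cM vol_fin hc) Dx Dy).
- move=> p Dp; apply: (dirichlet_weight_le cM vol_fin hc' hc _ (Dsub _ Dp)).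
  exact: (weight_ratio _ hB').
- move=> p Dp; apply: (dirichlet_weight_le cM vol_fin hc hc' _ Dp).
  exact: (weight_ratio _ hB).
- move=> p /(form_domainP g cM vol_fin hc)[_ Lp _ _].
  apply: (L2_inner_le ww ww' _ Lp) => x.
  by have := weight_ratio n%:R hB x; rewrite ger0_norm.
Qed.

Lemma spectrum_ge0 (h : M -> R) : continuous h -> forall z, spec h z -> 0 <= z.
Proof.
move=> hc z [sz _]; rewrite leNgt; apply/negP => z0; apply: sz.
apply/(resolvent_regular g cM vol_fin hc).
exact: (regular_neg (dirichlet_closed_form cM vol_fin basis hc) z0).
Qed.

(** The numbers below the nonzero spectrum for [h] become, once multiplied by the
    exponential, numbers below the nonzero spectrum for [h']. *)
Lemma spectral_gap_le (h h' : M -> R) (B : R) :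
  continuous h -> continuous h' -> (forall x, `|h' x - h x| <= B) ->
  spectral_gap g vol h * expR (- (conf_exponent * B)) <= spectral_gap g vol h'.
Proof.
have move_spec (k k' : M -> R) : continuous k -> continuous k' ->
    (forall x, `|k' x - k x| <= B) -> forall eps : R, 0 < eps ->
    (forall z, spec k z -> eps <= z) ->
    forall z, spec k' z -> eps * expR (- (conf_exponent * B)) <= z.
  move=> kc kc' kB eps e0 sk z [sz z0].
  have B0 : 0 <= B by exact: le_trans (normr_ge0 _) (kB point).
  have ge0 : 0 < eps * expR (- (conf_exponent * B)) by rewrite mulr_gt0 ?expR_gt0.
  apply: ((energy_gap_spectrum cM vol_fin basis kc' ge0).1 _ z sz z0).
  apply: (energy_gap_field kc kc' B0 (ltW e0) kB).
  by apply/(energy_gap_spectrum cM vol_fin basis kc e0) => y sy y0; apply: sk.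
move=> hc hc' hB; apply: inf_comparison.
- exact: expR_gt0.
- exact: spectrum_ge0.
- exact: spectrum_ge0.
- exact: move_spec.
- by apply: move_spec => // x; rewrite distrC.
Qed.

Lemma ln_spectral_gap_le (h h' : M -> R) (B : R) :
  continuous h -> continuous h' -> (forall x, `|h' x - h x| <= B) ->
  `|ln (spectral_gap g vol h') - ln (spectral_gap g vol h)| <= conf_exponent * B.
Proof.
move=> hc hc' hB; have B0 : 0 <= B by exact: le_trans (normr_ge0 _) (hB point).
apply: ln_ratio.
- by apply: inf_ge0; exact: spectrum_ge0.
- by apply: inf_ge0; exact: spectrum_ge0.
- by rewrite mulr_ge0// ltW// conf_exponent_gt0.
- exact: spectral_gap_le.
- by apply: spectral_gap_le => // x; rewrite distrC.
Qed.

End SpectralGapBound.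

Lemma sup_norm_ge0 (R : realType) (T : pointedType) (f : T -> R) :
  0 <= sup [set `|f x| | x in [set: T]].
Proof.
have [fs|fs] := pselect (has_sup [set `|f x| | x in [set: T]]); last by rewrite sup_out.
apply: (@le_trans _ _ `|f point|) => //.
by apply: ub_le_sup; [case: fs|exists point].
Qed.

Theorem theorem1p5 (R : realType) (n : nat) (M : ptopologicalType)
    (X : smooth_atlas R n M) (g : riemannian_metric X)
    (vol : {measure set (borel M) -> \bar R})
    (d : measure_display) (Omega : measurableType d) (P : probability Omega R)
    (m s : R) (h : Omega -> M -> R) :
  (0 < n)%N ->
  compact [set: M] -> hausdorff_space M -> connected [set: M] ->
  riemannian_volume g vol ->
  0 < m -> n%:R / 2 < s ->
  fractional_gaussian_field g vol P m s h ->
  ('E_P[fun omega => `|ln (spectral_gap g vol (h omega))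
                       - ln (spectral_gap g vol (fun=> 0))|%R]
   <= (if (2 <= n)%N then 2 * (n%:R - 1) else 2)%:E
      * 'E_P[fun omega => sup [set `|h omega x|%R | x in [set: M]]])%E.
Proof.
move=> n0 cM _ _ volg _ _ [hc hP].
have vol_fin := volume_finite volg cM.
have [_ [_ [_ [lam [e_ [basis _]]]] _]] := hP _ (@smooth_zero _ _ _ X).
rewrite unlock; apply: ae_le_integralZ.
- exact: (conf_exponent_gt0 R n0).
- by move=> omega; exact: normr_ge0.
- by move=> omega; exact: sup_norm_ge0.
apply: filterS hc => omega hc.
apply: (ln_spectral_gap_le n0 cM vol_fin basis) => //.
  exact: cst_continuous.
move=> x; rewrite subr0; apply: ub_le_sup; last by exists x.
by have [C CP] := compact_continuous_bounded cM hc; exists C => _ [y _ <-].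
Qed.
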